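(* Suppose we are given a primal and dual feasible LP $\min\{c^Tx\mid Ax=b,\ x\ge\ell\}$ with rational data and a limited-precision LP-basis oracle with constants $p$, $\eta$, and $\sigma$ (which does not report failure on the calls made). Fix a scaling limit $\alpha\ge2$ and let $\epsilon:=\max\{\eta,1/\alpha\}$. Then the algorithm Iterative Refinement with Rational Reconstruction (defined in the context), called with error correction factor $\beta<1/\epsilon$ (where $\beta>1$), terminates with an optimal solution in oracle-polynomial running time, i.e., with a number of oracle calls and a number of bit operations that are polynomial in the size of $A,b,\ell,c$.
   Context: All logarithms are base two. Encoding length (size): $\langle z\rangle := 1+\lceil\log(|z|+1)\rceil$ for $z\in\mathbb{Z}$; $\langle r/q\rangle:=\langle r\rangle+\langle q\rangle$ for a rational number $r/q$ in lowest terms with $q>0$; the size of a vector or matrix is the sum of the sizes of its entries; the size of several objects is the sum of their sizes. $\|\cdot\|_\infty$ is the maximum norm and $\mathbb{1}$ the all-ones vector. The LP is $\min\{c^T x \mid Ax=b,\ x\ge\ell\}$ with $A\in\mathbb{Q}^{m\times n}$ of full row rank, $m\le n$, $b\in\mathbb{Q}^m$, $c,\ell\in\mathbb{Q}^n$. A basis is a set $\mathcal{B}\subseteq\{1,\ldots,n\}$ of $m$ indices such that the columns $A_{\cdot i}$, $i\in\mathcal{B}$, are linearly independent. A pair $x,y$ is optimal if $Ax=b$, $x\ge\ell$, $c-A^Ty\ge0$ and $(x-\ell)^T(c-A^Ty)=0$. Let $\mathbb{F}(p):=\{n/2^p\in\mathbb{Q} : n\in\mathbb{Z},\ |n|\le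 2^{2p}\}$. A limited-precision LP-basis oracle is an oracle for which there exist constants $p\in\mathbb{N}$, $0<\eta<1$, $\sigma>0$ such that for any LP $\min\{c^Tx : Ax=b,\ x\ge\ell\}$ with rational data, when given the LP obtained by rounding all numbers in $A,b,\ell,c$ to $\mathbb{F}(p)$, it either reports a ''failure'' or returns $\bar x\in\mathbb{F}(p)^n$, $\bar y\in\mathbb{F}(p)^m$ and a basis $\mathcal{B}$ satisfying, with respect to the unrounded data, $\|A\bar x-b\|_\infty\le\eta$, $\bar x\ge\ell-\eta\mathbb{1}$, $c-A^T\bar y\ge-\eta\mathbb{1}$, $|(\bar x-\ell)^T(c-A^T\bar y)|\le\sigma$, $|\bar x_i-\ell_i|\le\eta$ for all $i\notin\mathcal{B}$, and $|c_i-\bar y^TA_{\cdot i}|\le\eta$ for all $i\in\mathcal{B}$. ''Calling the oracle for'' an LP means passing it the rounded LP. The constants $p,\eta,\sigma$ and the parameters $\alpha,\beta,f$ are regarded as fixed. Rational reconstruction: for $a\in\mathbb{Q}$ and $M>0$, $\mathrm{round\_to\_denom}(a,M)$ returns the rational number $r/q$ with $1\le q\le M$ and $|r/q-a|<1/(2Mq)$ if it exists (it is then unique, and existence can be tested and the number computed in polynomial time by the extended Euclidean algorithm); otherwise the reconstruction attempt fails. Algorithm Iterative Refinement with Rational Reconstruction. Parameters: incremental scaling limit $\alpha\in\mathbb{N}$, $\alpha\ge2$; geometric reconstruction frequency $f\ge1$; error correction factor $\beta>1$. Set $\Delta_1:=1$, $k^*:=0$. Call the oracle for $\min\{c^Tx: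 Ax=b,\ x\ge\ell\}$, aborting on failure; let $(x_1,y_1)$ be the returned solution. For $k=1,2,\ldots$: (i) compute $\hat b:=b-Ax_k$, $\hat\ell:=\ell-x_k$, $\hat c:=c-A^Ty_k$; (ii) compute $\delta_k:=\max\{\max_j|\hat b_j|,\ \max_i\hat\ell_i,\ \max_i(-\hat c_i),\ |\sum_i-\hat\ell_i\hat c_i|\}$; if $\delta_k=0$, return $(x_k,y_k)$; (iii) replace $\delta_k$ by $\max\{\delta_k,\,1/(\alpha\Delta_k)\}$ and set $\Delta_{k+1}:=2^{\lceil\log(1/\delta_k)\rceil}$; (iv) if $k\ge k^*$: set $M_k:=\sqrt{\Delta_{k+1}/(2\beta^k)}$ and $x^*_i:=\mathrm{round\_to\_denom}((x_k)_i,M_k)$ for $i=1,\ldots,n$; if $x^*$ is exactly feasible, set $y^*_j:=\mathrm{round\_to\_denom}((y_k)_j,M_k)$ for $j=1,\ldots,m$, and if $x^*,y^*$ is exactly optimal, return $(x^*,y^* )$; if nothing was returned, set $k^*:=\lceil fk\rceil$; (v) call the oracle for $\min\{(\Delta_{k+1}\hat c)^Tx : Ax=\Delta_{k+1}\hat b,\ x\ge\Delta_{k+1}\hat\ell\}$, aborting on failure; let $(\hat x,\hat y)$ be the returned solution, and set $(x_{k+1},y_{k+1}):=(x_k,y_k)+\frac{1}{\Delta_{k+1}}(\hat x,\hat y)$. Exact rational arithmetic is used outside the oracle.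
   Formalization: As stated the claim fails for large σ (Δ_k can tend to 0). Proved for the algorithm verbatim when σ<1, and for every σ when the complementarity residual stays in the exit test but is dropped from the δ_k used for scaling in (iii); β and f are taken rational. *)

(* Defs.v *)
From HB Require Import structures.
From mathcomp Require Import all_boot all_order all_algebra.
From mathcomp Require Import zify ring lra reals.

Set Implicit Arguments.
Unset Strict Implicit.
Unset Printing Implicit Defensive.

Import Order.TTheory GRing.Theory Num.Theory.
Local Open Scope ring_scope.

(* min { c^T x | A x = b, x >= l } *)
Record lp (m n : nat) := LP {
  lpA : 'M[rat]_(m, n);
  lpb : 'cV[rat]_m;
  lpc : 'cV[rat]_n;
  lpl : 'cV[rat]_n }.

Definition primal_feasible m n (L : lp m n) (x : 'cV[rat]_n) : Prop :=
  lpA L *m x = lpb L /\ forall i, lpl L i 0 <= x i 0.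

Definition dual_feasible m n (L : lp m n) (y : 'cV[rat]_m) : Prop :=
  forall i, 0 <= (lpc L - (lpA L)^T *m y) i 0.

Definition optimal m n (L : lp m n) (x : 'cV[rat]_n) (y : 'cV[rat]_m) : Prop :=
  [/\ primal_feasible L x, dual_feasible L y
    & ((x - lpl L)^T *m (lpc L - (lpA L)^T *m y)) 0 0 = 0].

Definition is_basis m n (A : 'M[rat]_(m, n)) (B : {set 'I_n}) : bool :=
  (#|B| == m) && free [seq col i A | i <- enum B].

(* [up_log 2 k] is the least e with k <= 2 ^ e, i.e. the rounded-up log. *)
Definition zsize (z : int) : nat := (1 + up_log 2 `|z|.+1)%N.

Definition qsize (a : rat) : nat := (zsize (numq a) + zsize (denq a))%N.

Definition mxsize m n (A : 'M[rat]_(m, n)) : nat :=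
  (\sum_i \sum_j qsize (A i j))%N.

Definition lpsize m n (L : lp m n) : nat :=
  (mxsize (lpA L) + mxsize (lpb L) + mxsize (lpc L) + mxsize (lpl L))%N.

Definition limited (p : nat) (a : rat) : Prop :=
  exists2 z : int, `|z| <= 2 ^+ (2 * p) & a = z%:~R / 2 ^+ p.

(* Rounding to a nearest element of [limited p]: ties go up, and numbers   *)
(* beyond the largest magnitude 2 ^ p saturate.                            *)
Definition roundF (p : nat) (a : rat) : rat :=
  let z : rat := (Num.floor (a * 2 ^+ p + 2^-1))%:~R in
  Num.max (- 2 ^+ (2 * p)) (Num.min (2 ^+ (2 * p)) z) / 2 ^+ p.

Definition round_lp p m n (L : lp m n) : lp m n :=
  LP (map_mx (roundF p) (lpA L)) (map_mx (roundF p) (lpb L))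
     (map_mx (roundF p) (lpc L)) (map_mx (roundF p) (lpl L)).

Record answer (m n : nat) := Answer {
  ans_x : 'cV[rat]_n;
  ans_y : 'cV[rat]_m;
  ans_B : {set 'I_n} }.

(* [None] is the report of a failure. *)
Definition oracle := forall m n : nat, lp m n -> option (answer m n).

(* The oracle sees the rounded LP only; its guarantees are about the       *)
(* unrounded one.                                                          *)
Definition limited_precision_lp_basis_oracle (R : realType)
    (p : nat) (eta sigma : R) (O : oracle) : Prop :=
  forall (m n : nat) (L : lp m n), row_free (lpA L) ->
  match O m n (round_lp p L) with
  | None => True
  | Some (Answer x y B) =>
    let r := lpc L - (lpA L)^T *m y in
    [/\ (forall i, limited p (x i 0)) /\ (forall j, limited p (y j 0)),
        is_basis (lpA L) B,
        [/\ forall j, ratr `|(lpA L *m x - lpb L) j 0| <= eta,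
            forall i, ratr (lpl L i 0) - eta <= ratr (x i 0)
          & forall i, - eta <= ratr (r i 0)],
        ratr `|((x - lpl L)^T *m r) 0 0| <= sigma
      & (forall i, i \notin B -> ratr `|(x - lpl L) i 0| <= eta) /\
        (forall i, i \in B -> ratr `|r i 0| <= eta)]
  end.

Record comp (T : Type) := Comp { cval : T; cbits : nat; ccalls : nat }.

Definition ret T (v : T) : comp T := Comp v 0 0.

Definition bind T U (c : comp T) (k : T -> comp U) : comp U :=
  let d := k (cval c) in
  Comp (cval d) (cbits c + cbits d) (ccalls c + ccalls d).

Notation "'let*' x := c 'in' k" := (bind c (fun x => k))
  (at level 200, x name, c at level 200, k at level 200).

(* All arithmetic below goes through the operations charged here.          *)
(* Schoolbook arithmetic on numerators and denominators, with Euclid's     *)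
(* algorithm to return to lowest terms, takes O(s^2) bit operations on     *)
(* rationals of total size s.                                              *)
Definition charge2 T (v : T) (a b : rat) : comp T :=
  Comp v ((qsize a + qsize b) ^ 2) 0.
Definition charge1 T (v : T) (a : rat) : comp T := Comp v (qsize a ^ 2) 0.

Definition qadd (a b : rat) := charge2 (a + b) a b.
Definition qsub (a b : rat) := charge2 (a - b) a b.
Definition qmul (a b : rat) := charge2 (a * b) a b.
Definition qdiv (a b : rat) := charge2 (a / b) a b.
Definition qle (a b : rat) := charge2 (a <= b) a b.
Definition qlt (a b : rat) := charge2 (a < b) a b.
Definition qeq (a b : rat) := charge2 (a == b) a b.
Definition qmax (a b : rat) := charge2 (Num.max a b) a b.
Definition qmin (a b : rat) := charge2 (Num.min a b) a b.
Definition qopp (a : rat) := charge1 (- a) a.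
Definition qabs (a : rat) := charge1 `|a| a.
Definition qfloor (a : rat) := charge1 ((Num.floor a)%:~R : rat) a.
Definition qceil (a : rat) := charge1 ((Num.ceil a)%:~R : rat) a.
Definition nsucc (k : nat) := charge1 k.+1 k%:R.

Fixpoint qpow (a : rat) (k : nat) : comp rat :=
  if k is k'.+1 then let* r := qpow a k' in qmul a r else ret 1.

Definition cfun n T (g : 'I_n -> comp T) : comp ('I_n -> T) :=
  Comp (fun i => cval (g i)) (\sum_i cbits (g i)) (\sum_i ccalls (g i)).

Definition cvec n (g : 'I_n -> comp rat) : comp 'cV[rat]_n :=
  let* v := cfun g in ret (\col_i v i).

Definition cmat m n (g : 'I_m -> 'I_n -> comp rat) : comp 'M[rat]_(m, n) :=
  let* v := cfun (fun i => cfun (g i)) in ret (\matrix_(i, j) v i j).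

Definition cvec_opt n (g : 'I_n -> comp (option rat)) :
    comp (option 'cV[rat]_n) :=
  let* v := cfun g in
  ret (if [forall i, isSome (v i)] then Some (\col_i odflt 0 (v i)) else None).

Definition csum n (g : 'I_n -> comp rat) : comp rat :=
  foldr (fun i c => let* s := c in let* t := g i in qadd t s)
        (ret 0) (enum 'I_n).

(* Maximum of 0 and the given values. *)
Definition cmax n (g : 'I_n -> comp rat) : comp rat :=
  foldr (fun i c => let* s := c in let* t := g i in qmax t s)
        (ret 0) (enum 'I_n).

Definition cforall n (g : 'I_n -> comp bool) : comp bool :=
  foldr (fun i c => let* s := c in let* t := g i in ret (t && s))
        (ret true) (enum 'I_n).

Lemma cval_csum n (g : 'I_n -> comp rat) :
  cval (csum g) = \sum_i cval (g i).
Proof.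
rewrite /csum -big_enum; elim: (enum _) => [|i s IH]; first by rewrite big_nil.
by rewrite big_cons -IH.
Qed.

Lemma cval_cmax n (g : 'I_n -> comp rat) :
  cval (cmax g) = \big[Num.max/0]_i cval (g i).
Proof.
rewrite /cmax -big_enum; elim: (enum _) => [|i s IH]; first by rewrite big_nil.
by rewrite big_cons -IH.
Qed.

Lemma cval_cforall n (g : 'I_n -> comp bool) :
  cval (cforall g) = [forall i, cval (g i)].
Proof.
transitivity (all (fun i => cval (g i)) (enum 'I_n)).
  by rewrite /cforall; elim: (enum _) => [//|i s /= ->].
by apply/allP/forallP => h i; rewrite ?h // mem_enum.
Qed.

(* Also used with A^T, for the reduced costs c - A^T y.                    *)
Definition residual m n (A : 'M[rat]_(m, n)) (b : 'cV[rat]_m)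
    (x : 'cV[rat]_n) : comp 'cV[rat]_m :=
  cvec (fun j => let* t := csum (fun i => qmul (A j i) (x i 0)) in
                 qsub (b j 0) t).

Lemma cval_residual m n (A : 'M[rat]_(m, n)) b x :
  cval (residual A b x) = b - A *m x.
Proof.
apply/matrixP=> j k; rewrite (ord1 k) !mxE /=; congr (_ - _).
exact: cval_csum.
Qed.

Definition qround (p : nat) (a : rat) : comp rat :=
  let* t := qmul a (2 ^+ p) in
  let* t := qadd t 2^-1 in
  let* z := qfloor t in
  let* z := qmin (2 ^+ (2 * p)) z in
  let* z := qmax (- 2 ^+ (2 * p)) z in
  qdiv z (2 ^+ p).

Lemma cval_qround p a : cval (qround p a) = roundF p a.
Proof. by []. Qed.

Fixpoint pow2_up (fuel : nat) (a D : rat) : comp rat :=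
  if fuel is fuel'.+1 then
    let* t := qmul a D in
    let* stop := qle 1 t in
    if stop then ret D else let* D' := qmul 2 D in pow2_up fuel' a D'
  else ret D.

Fixpoint pow2_down (fuel : nat) (a D : rat) : comp rat :=
  if fuel is fuel'.+1 then
    let* D' := qdiv D 2 in
    let* t := qmul a D' in
    let* go := qle 1 t in
    if go then pow2_down fuel' a D' else ret D
  else ret D.

(* The least power of two, with an exponent in Z, that is at least 1 / a.  *)
Definition scale_factor (a : rat) : comp rat :=
  let* big := qle 1 a in
  if big then pow2_down (qsize a) a 1 else pow2_up (qsize a) a 1.

(* Euclid's algorithm on numerator and denominator of a, written as the    *)
(* continued fraction expansion of a.  Here x is the current complete      *)
(* quotient and h1/k1, h0/k0 are the last two convergents; the first       *)
(* convergent h/k with k <= M and |h/k - a| < 1 / (2 M k) is returned.     *)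
(* M is given by its square M2, as M itself may be irrational.             *)
Fixpoint convergents (fuel : nat) (M2 a x h1 k1 h0 k0 : rat) :
    comp (option rat) :=
  if fuel is fuel'.+1 then
    let* t := qfloor x in
    let* th := qmul t h1 in
    let* h := qadd th h0 in
    let* tk := qmul t k1 in
    let* k := qadd tk k0 in
    let* kk := qmul k k in
    let* small := qle kk M2 in
    if small then
      let* ak := qmul a k in
      let* e := qsub h ak in
      let* ee := qmul e e in
      let* Me := qmul M2 ee in
      let* Me4 := qmul 4 Me in
      let* close := qlt Me4 1 in
      if close then let* r := qdiv h k in ret (Some r)
      else
        let* y := qsub x t in
        let* exact := qeq y 0 in
        if exact then ret None
        else let* z := qdiv 1 y in convergents fuel' M2 a z h k h1 k1
    else ret None
  else ret None.

(* Denominators of the complete quotients strictly decrease, so that the   *)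
(* fuel is never exhausted.                                                *)
Definition round_to_denom (a M2 : rat) : comp (option rat) :=
  convergents `|denq a|.+1 M2 a a 1 0 0 1.

Lemma roundF_limited p a : limited p (roundF p a).
Proof.
set N : rat := 2 ^+ (2 * p); have N0 : 0 <= N by rewrite exprn_ge0.
exists (Num.max (- 2 ^+ (2 * p)) (Num.min (2 ^+ (2 * p))
          (Num.floor (a * 2 ^+ p + 2^-1)))).
  have N0' : (0 : int) <= 2 ^+ (2 * p) by rewrite exprn_ge0.
  rewrite ler_norml le_max lexx /= ge_max ge_min lexx /= andbT.
  by rewrite (le_trans _ N0') // oppr_le0.
rewrite /roundF; congr GRing.mul.
set z := Num.floor _.
have NE : N = (2 ^+ (2 * p) : int)%:~R by rewrite rmorphXn.
rewrite -/N NE -rmorphN /=.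
have E (u v : int) : Num.max u%:~R v%:~R = (Num.max u v)%:~R :> rat.
  by rewrite !maxEle ler_int; case: ifP.
have E' (u v : int) : Num.min u%:~R v%:~R = (Num.min u v)%:~R :> rat.
  by rewrite !minEle ler_int; case: ifP.
by rewrite E' E.
Qed.

Lemma roundF_nearest p a b : limited p b -> `|a - roundF p a| <= `|a - b|.
Proof.
move=> [w Nw ->] {b}.
have s0 : 0 < 2 ^+ p :> rat by rewrite exprn_gt0.
set s : rat := 2 ^+ p in s0 *; set N : rat := 2 ^+ (2 * p).
have {}Nw : `|w%:~R| <= N :> rat.
  have -> : N = (2 ^+ (2 * p) : int)%:~R by rewrite rmorphXn.
  by rewrite -intr_norm ler_int.
have red (u : rat) : `|a - u / s| = `|a * s - u| / s.
  have -> : a - u / s = (a * s - u) / s by rewrite mulrBl mulfK ?gt_eqF.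
  by rewrite normrM [`|s^-1|]gtr0_norm ?invr_gt0.
rewrite /roundF -/N -/s !red ler_pM2r ?invr_gt0 //.
set t := a * s; set z := Num.floor _.
have /andP[z1 z2] := floor_itv (t + 2^-1).
rewrite -/z intrD in z1 z2; have := Nw; rewrite ler_norml => /andP[w1 w2].
have wz : [\/ w%:~R <= z%:~R - 1 :> rat, w%:~R = z%:~R :> rat
             | z%:~R + 1 <= w%:~R :> rat].
  have [h|h|->] := ltrgtP w z; [apply: Or31|apply: Or33|exact: Or32].
    by rewrite lerBrDr -(intrD _ _ 1) ler_int; lia.
  by rewrite -(intrD _ _ 1) ler_int; lia.
rewrite ler_norml !maxEle !minEle.
have N2 : - N <= N by exact: le_trans w1 w2.
case: (leP N z%:~R) => h1; rewrite ?N2; last case: (leP (- N)) => h2;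
  case: wz => wz; case: (ger0P (t - w%:~R)) => h3; apply/andP; split; lra.
Qed.

Lemma qsize_bounds (a : rat) : 0 < a ->
  a <= 2 ^+ qsize a /\ a^-1 <= 2 ^+ qsize a.
Proof.
move=> a0; have up (z : int) : `|z|%:~R <= 2 ^+ zsize z :> rat.
  rewrite -[`|z|%R]abszE -pmulrn -natrX ler_nat.
  apply: leq_trans (leq_trans (leqnSn _) (up_logP _ (isT : 1 < 2)%N)) _.
  by rewrite leq_exp2l // leqnSn.
have ge1 k : 1 <= 2 ^+ k :> rat by rewrite exprn_ege1.
have n0 : 0 < (numq a)%:~R :> rat by rewrite ltr0z numq_gt0.
have n1 : 1 <= (numq a)%:~R :> rat by rewrite ler1z -gtz0_ge1 numq_gt0.
have d0 : 0 < (denq a)%:~R :> rat by rewrite ltr0z denq_gt0.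
have d1 : 1 <= (denq a)%:~R :> rat by rewrite ler1z -gtz0_ge1 denq_gt0.
have := up (numq a); have := up (denq a).
rewrite !ger0_norm ?denq_ge0 ?numq_ge0 ?(ltW a0) // => hd hn.
rewrite -[X in X <= _ /\ _]divq_num_den.
rewrite -[X in _ /\ X^-1 <= _]divq_num_den invf_div /qsize exprD; split.
  rewrite ler_pdivrMr //; apply: le_trans hn _.
  by rewrite -mulrA ler_peMr ?exprn_ge0 // mulr_ege1.
rewrite ler_pdivrMr //; apply: le_trans hd _.
by rewrite mulrAC ler_peMl ?exprn_ge0 // mulr_ege1.
Qed.

Lemma cval_pow2_up fuel (a : rat) (e : int) : 0 < a ->
  2 ^ (e - 1) < a^-1 -> a^-1 <= 2 ^ (e + fuel%:Z) ->
  exists e' : int, [/\ cval (pow2_up fuel a (2 ^ e)) = 2 ^ e',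
    2 ^ (e' - 1) < a^-1 & a^-1 <= 2 ^ e'].
Proof.
move=> a0; elim: fuel e => [|fuel IH] e h1 h2 /=.
  by exists e; rewrite addr0 in h2.
rewrite (_ : (1 <= a * 2 ^ e) = (a^-1 <= 2 ^ e)); last first.
  by rewrite -[a^-1]mul1r ler_pdivrMr // [a * _]mulrC.
case: leP => h3; [by exists e|rewrite /=].
have E : 2 * 2 ^ e = 2 ^ (e + 1) :> rat by rewrite expfzDr // expr1z mulrC.
rewrite E; apply: IH; first by rewrite addrK.
by rewrite -addrA -PoszD add1n.
Qed.

Lemma cval_pow2_down fuel (a : rat) (e : int) : 0 < a ->
  a^-1 <= 2 ^ e -> 2 ^ (e - 1 - fuel%:Z) < a^-1 ->
  exists e' : int, [/\ cval (pow2_down fuel a (2 ^ e)) = 2 ^ e',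
    2 ^ (e' - 1) < a^-1 & a^-1 <= 2 ^ e'].
Proof.
move=> a0; elim: fuel e => [|fuel IH] e h1 h2 /=.
  by exists e; rewrite subr0 in h2.
have E : 2 ^ e / 2 = 2 ^ (e - 1) :> rat by rewrite expfzDr // exprN1.
rewrite E (_ : (1 <= a * 2 ^ (e - 1)) = (a^-1 <= 2 ^ (e - 1))); last first.
  by rewrite -[a^-1]mul1r ler_pdivrMr // [a * _]mulrC.
case: leP => h3; last by exists e.
apply: IH => //; suff -> : e - 1 - 1 - fuel%:Z = e - 1 - fuel.+1%:Z by [].
lia.
Qed.

(* The exponent of [scale_factor a] is the rounded-up logarithm of 1 / a.  *)
Lemma scale_factorP (a : rat) : 0 < a -> exists e : int,
  cval (scale_factor a) = 2 ^ e /\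
  forall e' : int, (a^-1 <= 2 ^ e') = (e <= e').
Proof.
move=> a0; have [b1 b2] := qsize_bounds a0.
suff [e [-> h2 h1]] : exists e : int, [/\ cval (scale_factor a) = 2 ^ e,
    2 ^ (e - 1) < a^-1 & a^-1 <= 2 ^ e].
  exists e; split=> // e'; apply/idP/idP => h.
    have := lt_le_trans h2 h; rewrite ltr_eXz2l ?ltr1n //; lia.
  by apply: le_trans h1 _; rewrite ler_eXz2l ?ltr1n.
have lt_down : 2 ^ (0 - 1 - (qsize a)%:Z) < a^-1 :> rat.
  have -> : 0 - 1 - (qsize a)%:Z = - (qsize a).+1%:Z by lia.
  rewrite -invr_expz ltf_pV2 ?posrE ?exprz_gt0 //.
  by apply: le_lt_trans b1 _; rewrite !exprnP ltr_eXz2l ?ltr1n //; lia.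
have lt_up : a < 1 -> 2 ^ (0 - 1) < a^-1 :> rat.
  move=> h; rewrite sub0r exprN1; apply: (@lt_trans _ _ 1); first by [].
  by rewrite invf_gt1.
rewrite /scale_factor /=; case: (leP 1 a) => h.
  have := @cval_pow2_down (qsize a) a 0 a0; rewrite expr0z; apply.
    by rewrite invf_le1.
  exact: lt_down.
have := @cval_pow2_up (qsize a) a 0 a0; rewrite expr0z; apply.
  exact: lt_up.
by rewrite add0r.
Qed.

Definition good_approx (a M2 : rat) (u v : int) : Prop :=
  [/\ (0 < v)%R, v%:~R ^+ 2 <= M2 & 4 * (M2 * (u%:~R - a * v%:~R) ^+ 2) < 1].

Lemma good_approx_unique a M2 u v u' v' :
  good_approx a M2 u v -> good_approx a M2 u' v' ->
  u%:~R / v%:~R = u'%:~R / v'%:~R :> rat.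
Proof.
move=> [v0 vM g] [v0' vM' g'].
have V0 : 0 < v%:~R :> rat by rewrite ltr0z.
have V0' : 0 < v'%:~R :> rat by rewrite ltr0z.
suff lt1 : `|(u * v' - u' * v)%:~R| < 1 :> rat.
  have E : u * v' = u' * v.
    by move: lt1; rewrite -intr_norm (ltr_int _ _ 1); lia.
  apply/eqP; rewrite eqr_div ?(gt_eqF V0) ?(gt_eqF V0') //; apply/eqP.
  by rewrite -!intrM E.
have aux (e w : rat) : w ^+ 2 <= M2 -> 4 * (M2 * e ^+ 2) < 1 -> `|e * w| < 2^-1.
  move=> h1 h2; rewrite -[2^-1]ger0_norm // -ltr_sqr ?nnegrE //.
  rewrite -!normrX !ger0_norm ?sqr_ge0 // exprMn mulrC.
  have : w ^+ 2 * e ^+ 2 <= M2 * e ^+ 2 by rewrite ler_wpM2r ?sqr_ge0.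
  by rewrite expr2; lra.
have := aux _ _ vM' g; have := aux _ _ vM g'.
rewrite !ltr_norml intrB !intrM; lra.
Qed.

Lemma convergents_sound fuel M2 a (x : rat) (h1 k1 h0 k0 : int) r :
  (k1 = 0 /\ k0 = 1) \/ [/\ 0 < k1, 0 <= k0 & 1 < x] ->
  cval (convergents fuel M2 a x h1%:~R k1%:~R h0%:~R k0%:~R) = Some r ->
  exists u v : int, r = u%:~R / v%:~R /\ good_approx a M2 u v.
Proof.
elim: fuel x h1 k1 h0 k0 => [//|fuel IH] x h1 k1 h0 k0 hk /=.
rewrite -!(intrM rat) -!(intrD rat) -!(intrM rat).
set t := Num.floor x; set h := t * h1 + h0; set k := t * k1 + k0.
have k_gt0 : 0 < k.
  case: hk => [[k10 k01]|[k10 k00 x1]]; first by rewrite /k k10 k01 mulr0.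
  have t1 : 1 <= t by rewrite floor_ge_int ltW.
  rewrite /k; nia.
case: ifP => // small; rewrite /=.
case: ifP => [close [<-]|_ /=].
  exists h, k; split=> //; split=> //.
  by rewrite expr2 -intrM.
case: ifP => // nz /=; apply: IH; right; split=> //.
  by case: hk => [[-> _]|[/ltW]].
rewrite div1r; have /andP[t1 t2] := floor_itv x.
rewrite invf_gt1; first by rewrite intrD in t2; rewrite ltrBlDl.
by rewrite lt_neqAle eq_sym nz subr_ge0.
Qed.

Lemma convergents_complete fuel M2 a u v (x : rat) (h1 k1 h0 k0 N D : int) :
  good_approx a M2 u v ->
  (h1 * k0 - h0 * k1) ^+ 2 = 1 ->
  h0%:~R - a * k0%:~R = - x * (h1%:~R - a * k1%:~R) ->
  (k1 = 0 /\ k0 = 1) \/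
    [/\ 0 < k1, 0 <= k0, 1 < x, k1 <= v
      & 1 <= 4 * (M2 * (h1%:~R - a * k1%:~R) ^+ 2)] ->
  x = N%:~R / D%:~R -> 0 < D <= fuel%:Z ->
  exists r, cval (convergents fuel M2 a x h1%:~R k1%:~R h0%:~R k0%:~R) = Some r.
Proof.
move=> [v0 vM g].
elim: fuel x h1 k1 h0 k0 N D => [|fuel IH] x h1 k1 h0 k0 N D det lin hk xE.
  by move=> /andP[D0 D1]; exfalso; lia.
move=> /andP[D0 Df] /=.
rewrite -!(intrM rat) -!(intrD rat) -!(intrM rat).
set t := Num.floor x; set h := t * h1 + h0; set k := t * k1 + k0.
have /andP[t1 t2] := floor_itv x; rewrite -/t intrD in t1 t2.
have k_gt0 : 0 < k.
  case: hk => [[k10 k01]|[k10 k00 x1 _ _]]; first by rewrite /k k10 k01 mulr0.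
  have t_ge1 : 1 <= t by rewrite floor_ge_int ltW.
  rewrite /k; nia.
set e1 := h1%:~R - a * k1%:~R in lin hk.
have eE : h%:~R - a * k%:~R = - (x - t%:~R) * e1.
  by rewrite /h /k !intrD !intrM; rewrite /e1 in lin *; lra.
have kv : k <= v.
  have [//|vk] := leP k v; exfalso.
  case: hk => [[k10 k01]|[k10 k00 x1 k1v far]].
    by move: vk; rewrite /k k10 k01 mulr0 add0r; lia.
  pose s := h1 * k0 - h0 * k1.
  pose al := - s * (u * k1 - h1 * v); pose be := - s * (h * v - u * k).
  have sE : h * k1 - h1 * k = - s by rewrite /h /k /s; ring.
  have ss : s * s = 1 by rewrite -expr2.
  have uE : u = al * h + be * h1.
    have -> : al * h + be * h1 = - s * u * (h * k1 - h1 * k).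
      by rewrite /al /be; ring.
    by rewrite sE mulrAC mulrNN ss mul1r.
  have vE : v = al * k + be * k1.
    have -> : al * k + be * k1 = - s * v * (h * k1 - h1 * k).
      by rewrite /al /be; ring.
    by rewrite sE mulrAC mulrNN ss mul1r.
  clearbody al be.
  have errE : u%:~R - a * v%:~R = (be%:~R - al%:~R * (x - t%:~R)) * e1.
    have U : u%:~R = al%:~R * h%:~R + be%:~R * h1%:~R :> rat.
      by rewrite uE intrD !intrM.
    have V : v%:~R = al%:~R * k%:~R + be%:~R * k1%:~R :> rat.
      by rewrite vE intrD !intrM.
    transitivity (al%:~R * (h%:~R - a * k%:~R) + be%:~R * e1).
      by rewrite U V /e1; ring.
    by rewrite eE; ring.
  have c1 : 1 <= (be%:~R - al%:~R * (x - t%:~R)) ^+ 2 :> rat.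
    have f0 : 0 <= x - t%:~R by rewrite subr_ge0.
    have [al0|al0|al0] := ltrgtP al 0.
    - have b1 : 1 <= be by nia.
      have b1' : 1 <= be%:~R :> rat by rewrite ler1z.
      have al1 : al%:~R <= 0 :> rat by rewrite lerz0 ltW.
      by rewrite -[1](expr1n _ 2); apply: lerXn2r; rewrite ?nnegrE //; nra.
    - have b1 : be <= -1 by nia.
      have b1' : be%:~R <= -1 :> rat by rewrite -(ler_int rat) in b1.
      have al1 : 0 <= al%:~R :> rat by rewrite ler0z ltW.
      by rewrite -sqrrN -[1](expr1n _ 2); apply: lerXn2r; rewrite ?nnegrE //; nra.
    - have b1 : 1 <= be by nia.
      have b1' : 1 <= be%:~R :> rat by rewrite ler1z.
      by rewrite al0 mul0r subr0 -[1](expr1n _ 2); apply: lerXn2r; rewrite ?nnegrE //; lra.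
  have := g; rewrite errE exprMn ltNge => /negP; apply.
  apply: le_trans far _.
  rewrite [X in _ <= 4 * X]mulrCA [X in _ <= X]mulrCA ler_peMl //.
  have M0 : 0 <= M2 by apply: le_trans vM; exact: sqr_ge0.
  by apply: mulr_ge0 => //; apply: mulr_ge0 => //; exact: sqr_ge0.
have -> : (k * k)%:~R <= M2.
  apply: le_trans vM; rewrite expr2 -intrM ler_int; nia.
rewrite /=; case: ifP => [_|far]; first by eexists.
rewrite /=.
case: eqP => [x0|/eqP nz].
  move: far; rewrite eE x0 oppr0 mul0r !mulr0; by rewrite ltr01.
have nz0 : 0 < x - t%:~R by rewrite lt_neqAle eq_sym nz subr_ge0.
have D0r : 0 < D%:~R :> rat by rewrite ltr0z.
have yE : x - t%:~R = (N - t * D)%:~R / D%:~R.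
  by rewrite intrB intrM xE mulrBl mulfK ?gt_eqF.
apply: (IH _ _ _ _ _ D (N - t * D)).
- by rewrite -det /h /k; ring.
- by rewrite -/e1 eE /= !mulNr mulrN opprK mulrA div1r mulVf // mul1r.
- right; split=> //.
  + by case: hk => [[-> _]|[/ltW]].
  + by rewrite /= div1r invf_gt1 //; lra.
  + by rewrite leNgt expr2 far.
- by rewrite /= yE div1r invf_div.
- have : 0 < (N - t * D)%:~R :> rat.
    by move: nz0; rewrite yE pmulr_lgt0 ?invr_gt0.
  have : (N - t * D)%:~R < D%:~R :> rat.
    by rewrite -[X in _ < X]mul1r -ltr_pdivrMr // -yE; lra.
  rewrite ltr_int ltr0z; lia.
Qed.

(* With M the square root of M2, [round_to_denom a M2] finds the rational  *)
(* number u / v with 1 <= v <= M and |u / v - a| < 1 / (2 M v) if there is  *)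
(* one, and fails otherwise.                                               *)
Lemma round_to_denomP (R : rcfType) (a M2 r : rat) : 0 < M2 ->
  let M : R := Num.sqrt (ratr M2) in
  cval (round_to_denom a M2) = Some r <->
  exists u v : int, [/\ r = u%:~R / v%:~R, 1 <= v, v%:~R <= M
    & ratr `|u%:~R / v%:~R - a| < (2 * M * v%:~R)^-1].
Proof.
move=> M20 M; have R0 : 0 < ratr M2 :> R by rewrite ltr0q.
have M0 : 0 < M by rewrite sqrtr_gt0.
have ME : M ^+ 2 = ratr M2 by rewrite sqr_sqrtr // ltW.
have specE (u v : int) : 0 < v -> good_approx a M2 u v <->
    v%:~R <= M /\ ratr `|u%:~R / v%:~R - a| < (2 * M * v%:~R)^-1.
  move=> v0; have V0 : 0 < v%:~R :> R by rewrite ltr0z.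
  have Vq : 0 < v%:~R :> rat by rewrite ltr0z.
  have -> : (v%:~R <= M) = (v%:~R ^+ 2 <= M2).
    rewrite -(ler_rat R) rmorphXn /= rmorph_int -ME ler_sqr //.
      by rewrite nnegrE ltW.
    by rewrite nnegrE ltW.
  set e := u%:~R - a * v%:~R.
  have eE : u%:~R / v%:~R - a = e / v%:~R.
    by rewrite /e mulrBl mulfK ?gt_eqF.
  have -> : (ratr `|u%:~R / v%:~R - a| < (2 * M * v%:~R)^-1) =
            (4 * (M2 * e ^+ 2) < 1).
    rewrite eE normrM normfV (gtr0_norm Vq) rmorphM fmorphV rmorph_int /=.
    rewrite invfM ltr_pM2r ?invr_gt0 // -[_^-1]mul1r ltr_pdivlMr ?mulr_gt0 //.
    have E : ratr (4 * (M2 * e ^+ 2)) = (ratr `|e| * (2 * M)) ^+ 2 :> R.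
      have -> : e ^+ 2 = `|e| * `|e| by rewrite -expr2 real_normK // num_real.
      by rewrite !rmorphM /= (ratr_nat R 4) -ME; ring.
    rewrite -(ltr_rat R) rmorph1 E.
    by rewrite expr_lt1 // mulr_ge0 ?ler0q // mulr_ge0 // ltW.
  by split=> [[]|[]].
split.
  move=> h; have [||u [v [-> g]]] :=
    @convergents_sound `|denq a|.+1 M2 a a 1 0 0 1 r; [by left|exact: h|].
  exists u, v; have [v0 _ _] := g.
  by have [] := (specE u v v0).1 g; split.
move=> [u [v [-> v1 vM close]]].
have g : good_approx a M2 u v by apply/specE.
have [r' E] : exists r', cval (round_to_denom a M2) = Some r'.
  apply: (@convergents_complete _ M2 a u v a 1 0 0 1 (numq a) (denq a) g) => //.
  - by rewrite mulr1 mulr0 subr0 sub0r mulr1.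
  - by left.
  - by rewrite divq_num_den.
  - rewrite denq_gt0 /=; have := denq_gt0 a; lia.
rewrite E; congr Some.
have [||u' [v' [-> g']]] :=
  @convergents_sound `|denq a|.+1 M2 a a 1 0 0 1 r'; [by left|exact: E|].
exact: good_approx_unique g' g.
Qed.

Record params := Params {
  par_p : nat;           (* precision of the oracle *)
  par_alpha : nat;       (* incremental scaling limit *)
  par_beta : rat;        (* error correction factor *)
  par_f : rat;           (* geometric reconstruction frequency *)
  par_gap : bool }.      (* whether the gap enters the scaling residual *)

Record state (m n : nat) := State {
  st_k : nat;
  st_kstar : rat;        (* next iteration with a reconstruction attempt *)
  st_Delta : rat;
  st_x : 'cV[rat]_n;
  st_y : 'cV[rat]_m }.

Inductive outcome (m n : nat) :=
  | Aborted
  | Returned (x : 'cV[rat]_n) (y : 'cV[rat]_m).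
Arguments Aborted {m n}.

Definition call_oracle (O : oracle) p m n (L : lp m n) :
    comp (option (answer m n)) :=
  let* A := cmat (fun i j => qround p (lpA L i j)) in
  let* b := cvec (fun j => qround p (lpb L j 0)) in
  let* c := cvec (fun i => qround p (lpc L i 0)) in
  let* l := cvec (fun i => qround p (lpl L i 0)) in
  Comp (O m n (LP A b c l)) 0 1.

Lemma cval_call_oracle O p m n (L : lp m n) :
  cval (call_oracle O p L) = O m n (round_lp p L).
Proof.
rewrite /= /round_lp; congr (O m n (LP _ _ _ _)); apply/matrixP=> i j;
  by rewrite !mxE ?(ord1 j) // -cval_qround.
Qed.

Definition check_primal m n (L : lp m n) (x : 'cV[rat]_n) : comp bool :=
  let* r := residual (lpA L) (lpb L) x in
  let* eqs := cforall (fun j => qeq (r j 0) 0) in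
  let* bds := cforall (fun i => qle (lpl L i 0) (x i 0)) in
  ret (eqs && bds).

Definition check_optimal m n (L : lp m n) (x : 'cV[rat]_n) (y : 'cV[rat]_m) :
    comp bool :=
  let* pf := check_primal L x in
  let* r := residual (lpA L)^T (lpc L) y in
  let* df := cforall (fun i => qle 0 (r i 0)) in
  let* gap := csum (fun i => let* s := qsub (x i 0) (lpl L i 0) in
                             qmul s (r i 0)) in
  let* cs := qeq gap 0 in
  ret [&& pf, df & cs].

Lemma cval_check_primalP m n (L : lp m n) x :
  reflect (primal_feasible L x) (cval (check_primal L x)).
Proof.
have -> : cval (check_primal L x) =
    [forall j, (lpb L - lpA L *m x) j 0 == 0] &&
    [forall i, lpl L i 0 <= x i 0].
  by rewrite /check_primal /bind [LHS]/= !cval_cforall -cval_residual.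
apply: (iffP andP) => -[].
  move=> /forallP h1 /forallP h2; split=> //; apply/matrixP=> j k.
  by rewrite (ord1 k); have := h1 j; rewrite !mxE subr_eq0 => /eqP.
by move=> h1 h2; split; apply/forallP => // j; rewrite h1 subrr mxE.
Qed.

Lemma cval_check_optimalP m n (L : lp m n) x y :
  reflect (optimal L x y) (cval (check_optimal L x y)).
Proof.
set r := lpc L - (lpA L)^T *m y.
have -> : cval (check_optimal L x y) =
    [&& cval (check_primal L x), [forall i, 0 <= r i 0]
      & ((x - lpl L)^T *m r) 0 0 == 0].
  rewrite /r -cval_residual /check_optimal.
  rewrite mxE; congr (_ && _); rewrite [LHS]/= cval_cforall cval_csum.
  congr (_ && (_ == _)); apply: eq_bigr => i _.
  by rewrite [(x - _)^T _ _]mxE [(x - _) _ _]mxE [(- lpl L) _ _]mxE.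
apply: (iffP and3P) => -[].
  by move=> /cval_check_primalP ? /forallP ? /eqP ?; split.
by move=> ? ? ?; split; [exact/cval_check_primalP | exact/forallP | exact/eqP].
Qed.

(* [D] is the scaling factor Delta_(k+1). *)
Definition reconstruct (P : params) m n (L : lp m n) (k : nat) (D : rat)
    (x : 'cV[rat]_n) (y : 'cV[rat]_m) :
    comp (option ('cV[rat]_n * 'cV[rat]_m)) :=
  let* bk := qpow (par_beta P) k in
  let* d := qmul 2 bk in
  let* M2 := qdiv D d in
  let* ox := cvec_opt (fun i => round_to_denom (x i 0) M2) in
  if ox is Some xs then
    let* feas := check_primal L xs in
    if feas then
      let* oy := cvec_opt (fun j => round_to_denom (y j 0) M2) in
      if oy is Some ys then
        let* opt := check_optimal L xs ys in
        ret (if opt then Some (xs, ys) else None)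
      else ret None
    else ret None
  else ret None.

(* One pass through the loop.  The loop is left when all four violations,  *)
(* including the complementarity gap, vanish.  With [par_gap] the gap also *)
(* enters the residual delta that determines the next scaling factor;      *)
(* without it, delta is the largest primal or dual violation.  An oracle   *)
(* with sigma > 1 can keep the scaling factors from growing in the former  *)
(* variant, as it does not ensure gaps below 1.                            *)
Definition step (O : oracle) (P : params) m n (L : lp m n) (s : state m n) :
    comp (outcome m n + state m n) :=
  let: State k kstar D x y := s in
  let* bh := residual (lpA L) (lpb L) x in
  let* lh := cvec (fun i => qsub (lpl L i 0) (x i 0)) in
  let* ch := residual (lpA L)^T (lpc L) y in
  let* vb := cmax (fun j => qabs (bh j 0)) in
  let* vl := cmax (fun i => ret (lh i 0)) in
  let* vc := cmax (fun i => qopp (ch i 0)) in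
  let* sgap := csum (fun i => let* t := qopp (lh i 0) in qmul t (ch i 0)) in
  let* gap := qabs sgap in
  let* v := qmax vb vl in
  let* viol := qmax v vc in
  let* delta := qmax viol gap in
  let* done := qeq delta 0 in
  if done then ret (inl (Returned x y)) else
  let* aD := qmul (par_alpha P)%:R D in
  let* lim := qdiv 1 aD in
  let* delta' := qmax (if par_gap P then delta else viol) lim in
  let* D' := scale_factor delta' in
  let* try := qle kstar k%:R in
  let* res := if try then reconstruct P L k D' x y else ret None in
  if res is Some (xs, ys) then ret (inl (Returned xs ys)) else
  let* kstar' := if try then let* fk := qmul (par_f P) k%:R in qceil fk
                 else ret kstar in
  let* bs := cvec (fun j => qmul D' (bh j 0)) in
  let* cs := cvec (fun i => qmul D' (ch i 0)) in
  let* ls := cvec (fun i => qmul D' (lh i 0)) in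
  let* oa := call_oracle O (par_p P) (LP (lpA L) bs cs ls) in
  if oa is Some (Answer xh yh _) then
    let* x' := cvec (fun i => let* t := qdiv (xh i 0) D' in qadd (x i 0) t) in
    let* y' := cvec (fun j => let* t := qdiv (yh j 0) D' in qadd (y j 0) t) in
    let* k' := nsucc k in
    ret (inr (State k' kstar' D' x' y'))
  else ret (inl Aborted).

(* [loop s o bits calls]: the loop entered in state [s] terminates with    *)
(* outcome [o] after [bits] bit operations and [calls] oracle calls.       *)
Inductive loop (O : oracle) (P : params) m n (L : lp m n) :
    state m n -> outcome m n -> nat -> nat -> Prop :=
  | loop_exit s o : cval (step O P L s) = inl o ->
      loop O P L s o (cbits (step O P L s)) (ccalls (step O P L s))
  | loop_next s s' o bits calls : cval (step O P L s) = inr s' ->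
      loop O P L s' o bits calls ->
      loop O P L s o (cbits (step O P L s) + bits)
                     (ccalls (step O P L s) + calls).

Inductive run (O : oracle) (P : params) m n (L : lp m n) :
    outcome m n -> nat -> nat -> Prop :=
  | run_abort : cval (call_oracle O (par_p P) L) = None ->
      run O P L Aborted (cbits (call_oracle O (par_p P) L))
                        (ccalls (call_oracle O (par_p P) L))
  | run_loop x y B o bits calls :
      cval (call_oracle O (par_p P) L) = Some (Answer x y B) ->
      loop O P L (State 1 0 1 x y) o bits calls ->
      run O P L o (cbits (call_oracle O (par_p P) L) + bits)
                  (ccalls (call_oracle O (par_p P) L) + calls).

(* Main.v *)
(* The iterate of step k violates feasibility, optimality and the equations *)
(* of its basis by at most e / Delta_k, where max(eta, 1 / alpha) < e and   *)
(* e * beta < 1.  By Cramer's rule the exact basic solution of this basis   *)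
(* has a denominator Q at most N and a distance to the iterate of at most   *)
(* N / Delta_k with N = 2 ^ poly(size).  Once Delta_k exceeds 4 * N ^ 2,    *)
(* slacks and reduced costs of the basic solution, being multiples of 1 / Q *)
(* above - 1 / Q, are nonnegative, so that it is optimal.  Since            *)
(* Delta_(k+1) grows like e ^ -k, faster than beta ^ k, its denominator is  *)
(* then below the bound of the reconstruction, which therefore succeeds     *)
(* after polynomially many steps.  The iterates are multiples of            *)
(* 1 / (2 ^ p * Delta_k), and log Delta_k is linear in k, so all numbers    *)
(* have polynomial size.                                                    *)

Require Import Defs.
From HB Require Import structures.
From mathcomp Require Import all_boot all_order all_algebra.
From mathcomp Require Import perm zify ring lra reals.

Set Implicit Arguments.
Unset Strict Implicit.
Unset Printing Implicit Defensive.

Import Order.TTheory GRing.Theory Num.Theory.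
Local Open Scope ring_scope.

(** * Sizes of rational numbers *)

(** Fix a rational [e] strictly between max([eta], 1/[alpha]) and 1/[beta], and a rational [g] above
    [sigma]. An oracle answer for the residual problem scaled by [D], scaled back and added to the
    iterate, leaves violations and errors in the basis equations of at most [e / D] and a gap of at
    most [g / D ^+ 2] ([accurate_refine]). So the next scaling factor is at least [D / e], except in
    boundedly many early steps where the gap may dominate and the growth is only by 1/max([e], [g]).
    These steps cost a constant [c], giving [c <= D * e ^+ k] at step [k] ([next_factorP],
    [iterate_step]).

    The basis of an iterate defines an exact basic solution. With [E] quadratic in the size of the
    LP, it has a common denominator [Q <= 2 ^+ E] and lies within [2 ^+ E * (e / D)] of the iterate
    ([basic_solution]). Its slacks and reduced costs are multiples of [1 / Q], so for large [D] they
    cannot be negative, and it is optimal ([basic_optimal]). Reconstruction finds it if [Q <= M] and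
    its distance to the iterate is below [1 / (2 * M * Q)], where [M ^+ 2 = D' / (2 * beta ^+ k)]
    and [D'] is the next factor. As [D <= D' <= 2 * alpha * D], both follow from
    [D > 4 * alpha * 2 ^+ (4 * E) * beta ^+ k], which holds from some [k] linear in [E] on because
    [e * beta < 1] ([reconstruct_iterate]). The geometric spacing of the attempts delays success by
    a constant factor only ([loop_terminates]), and anything returned earlier has been checked
    exactly.

    For the bit operations, iterates lie on the grid of multiples of [1 / (2 ^+ p * D)] with [log D]
    linear in [k], so all numbers are short. Lengths are tracked by [bitbound], costs by [within]
    and polynomial growth by [polyb]; [polynomial_run] assembles the pieces. *)

Lemma denq_dvd (a : rat) (u v : int) : v != 0 -> a = u%:~R / v%:~R ->
  (denq a %| v)%Z.
Proof.
move=> v0 aE; have cop : coprimez (denq a) (numq a).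
  by rewrite coprimez_sym; exact: coprime_num_den.
rewrite -(Gauss_dvdzr _ cop); apply/dvdzP; exists u.
apply/eqP; rewrite -(eqr_int rat) !intrM; apply/eqP.
have V0 : v%:~R != 0 :> rat by rewrite intr_eq0.
have D0 : (denq a)%:~R != 0 :> rat by rewrite intr_eq0 denq_eq0.
have nE : (numq a)%:~R = a * (denq a)%:~R by rewrite -{2}[a]divq_num_den divfK.
by rewrite nE aE; field.
Qed.

(** Any positive integer that clears the fraction is a multiple of its denominator, so the size
    bounds below never need lowest terms. *)
Lemma denq_le (a : rat) (v : int) : 0 < v -> a * v%:~R \is a Num.int ->
  denq a <= v.
Proof.
move=> v0 /intrP[u uE]; have V0 : v%:~R != 0 :> rat by rewrite intr_eq0 gt_eqF.
have /dvdzP[q qE] : (denq a %| v)%Z.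
  by apply: (@denq_dvd _ u); rewrite ?gt_eqF // -uE mulfK.
have d0 := denq_gt0 a; have : 0 < q by move: v0; rewrite qE pmulr_lgt0.
rewrite qE; nia.
Qed.

(* Unlike qsize, which may double at every addition, these bounds only add  *)
(* up in a sum, so that sums of many terms stay short.                      *)
Definition bitbound (s : nat) (a : rat) : bool :=
  ((denq a)%:~R <= 2 ^+ s :> rat) && (`|a| + 1 <= 2 ^+ s).

Lemma mul_denq (a : rat) : a * (denq a)%:~R = (numq a)%:~R.
Proof. by rewrite -{1}[a]divq_num_den divfK // intr_eq0 denq_eq0. Qed.

Lemma bitboundP (s : nat) (a : rat) (v : int) : 0 < v ->
  a * v%:~R \is a Num.int -> v%:~R <= 2 ^+ s :> rat -> `|a| + 1 <= 2 ^+ s ->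
  bitbound s a.
Proof.
move=> v0 av vs as_; rewrite /bitbound as_ andbT; apply: le_trans vs.
by rewrite ler_int denq_le.
Qed.

Lemma bitbound_le s t a : (s <= t)%N -> bitbound s a -> bitbound t a.
Proof.
move=> st /andP[h1 h2]; have h : 2 ^+ s <= 2 ^+ t :> rat.
  by rewrite ler_eXn2l ?ltr1n.
by rewrite /bitbound (le_trans h1 h) (le_trans h2 h).
Qed.

Lemma bitbound_int s (z : int) : `|z| + 1 <= 2 ^+ s -> bitbound s z%:~R.
Proof.
move=> h; apply: (@bitboundP _ _ 1) => //.
- by rewrite mulr1 intr_int.
- by rewrite exprn_ege1.
- by rewrite -intr_norm -(intrD _ _ 1) -[2]/(2%:~R) -rmorphXn ler_int.
Qed.

(** The [+ 1] in [bitbound] makes the bound additive: [|a| + |b| + 1] is at most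
    [(|a| + 1) * (|b| + 1)]. *)
Lemma bitbound_add s t a b :
  bitbound s a -> bitbound t b -> bitbound (s + t) (a + b).
Proof.
move=> /andP[da na] /andP[db nb].
apply: (@bitboundP _ _ (denq a * denq b)).
- by rewrite mulr_gt0 ?denq_gt0.
- rewrite intrM mulrDl mulrA mul_denq [b * _]mulrCA mul_denq.
  by rewrite rpredD // rpredM ?intr_int.
- by rewrite intrM exprD ler_pM // ler0z denq_ge0.
- apply: le_trans (_ : (`|a| + 1) * (`|b| + 1) <= _).
    have := ler_normD a b; have := normr_ge0 a; have := normr_ge0 b; nra.
  by rewrite exprD ler_pM // addr_ge0.
Qed.

Lemma bitbound_mul s t a b :
  bitbound s a -> bitbound t b -> bitbound (s + t) (a * b).
Proof.
move=> /andP[da na] /andP[db nb].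
apply: (@bitboundP _ _ (denq a * denq b)).
- by rewrite mulr_gt0 ?denq_gt0.
- by rewrite intrM mulrACA !mul_denq rpredM ?intr_int.
- by rewrite intrM exprD ler_pM // ler0z denq_ge0.
- rewrite normrM; apply: le_trans (_ : (`|a| + 1) * (`|b| + 1) <= _).
    have := normr_ge0 a; have := normr_ge0 b; nra.
  by rewrite exprD ler_pM // addr_ge0.
Qed.

Lemma bitbound_opp s a : bitbound s (- a) = bitbound s a.
Proof. by rewrite /bitbound denqN normrN. Qed.

Lemma bitbound_sub s t a b :
  bitbound s a -> bitbound t b -> bitbound (s + t) (a - b).
Proof. by move=> ha hb; apply: bitbound_add; rewrite ?bitbound_opp. Qed.

Lemma bitbound_norm s a : bitbound s a -> bitbound s `|a|.
Proof. by have [//|_] := ger0P a; rewrite bitbound_opp. Qed.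

Lemma bitbound0 s : bitbound s 0.
Proof. by apply: (@bitbound_int s 0); rewrite normr0 add0r exprn_ege1. Qed.

Lemma bitbound1 : bitbound 1 1.
Proof. by apply: (@bitbound_int 1 1); rewrite normr1 expr1. Qed.

Lemma bitbound_floor s a : bitbound s a -> bitbound s.+1 (Num.floor a)%:~R.
Proof.
move=> /andP[_ h]; apply: bitbound_int.
rewrite -(ler_int rat) intrD intr_norm rmorphXn /=.
have /andP[h1 h2] := floor_itv a; rewrite intrD in h2.
rewrite exprS; have : `|(Num.floor a)%:~R| <= `|a| + 1.
  by rewrite ler_norml; case: (ger0P a); lra.
have : 1 <= 2 ^+ s :> rat by rewrite exprn_ege1.
lra.
Qed.

Lemma bitbound_ceil s a : bitbound s a -> bitbound s.+1 (Num.ceil a)%:~R.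
Proof.
rewrite ceilNfloor intrN bitbound_opp -(bitbound_opp s); exact: bitbound_floor.
Qed.

(** The new denominator is the old numerator [|a| * denq a], at most [2 ^+ (s + s)], and the new
    magnitude is at most the old denominator; the extra bit pays for the [+ 1]. *)
Lemma bitbound_inv s a : bitbound s a -> bitbound (s + s).+1 a^-1.
Proof.
move=> /andP[d n]; have [->|a0] := eqVneq a 0; first by rewrite invr0 bitbound0.
have n0 : numq a != 0 by rewrite numq_eq0.
have nE : `|numq a|%:~R = `|a| * (denq a)%:~R :> rat.
  by rewrite intr_norm -mul_denq normrM -!intr_norm (gtr0_norm (denq_gt0 a)).
have aE : a^-1 = (denq a)%:~R / (numq a)%:~R.
  by rewrite -[a in LHS]divq_num_den invf_div.
have d1 : 1 <= (denq a)%:~R :> rat by rewrite ler1z -gtz0_ge1 denq_gt0.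
have n1 : 1 <= `|numq a|%:~R :> rat by rewrite ler1z -gtz0_ge1 normr_gt0.
have s1 : 1 <= 2 ^+ s :> rat by rewrite exprn_ege1.
have E : 2 ^+ (s + s).+1 = 2 * (2 ^+ s * 2 ^+ s) :> rat by rewrite exprS exprD.
apply: (@bitboundP _ _ `|numq a|); first by rewrite normr_gt0.
- rewrite aE intr_norm; have [_|_] := ger0P; last rewrite mulrN rpredN.
    by rewrite divfK ?intr_int // intr_eq0.
  by rewrite divfK ?intr_int // intr_eq0.
- rewrite nE E; have := normr_ge0 a; nra.
- have : `|a^-1| <= 2 ^+ s.
    rewrite aE normrM normfV -!intr_norm (gtr0_norm (denq_gt0 a)).
    apply: le_trans d; rewrite ler_pdivrMr; last exact: lt_le_trans n1.
    by rewrite ler_peMr //; lra.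
  rewrite E; nra.
Qed.

Lemma bitbound_div s t a b :
  bitbound s a -> bitbound t b -> bitbound (s + (t + t).+1) (a / b).
Proof. by move=> ha hb; apply: bitbound_mul => //; exact: bitbound_inv. Qed.

Lemma bitbound_max s t a b :
  bitbound s a -> bitbound t b -> bitbound (s + t) (Num.max a b).
Proof.
move=> ha hb; rewrite maxEle; case: ifP => _.
  by apply: bitbound_le hb; rewrite leq_addl.
by apply: bitbound_le ha; rewrite leq_addr.
Qed.

Lemma bitbound_min s t a b :
  bitbound s a -> bitbound t b -> bitbound (s + t) (Num.min a b).
Proof.
move=> ha hb; rewrite minEle; case: ifP => _.
  by apply: bitbound_le ha; rewrite leq_addr.
by apply: bitbound_le hb; rewrite leq_addl.
Qed.

Lemma bitbound_nat (k : nat) : bitbound k.+1 k%:R.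
Proof.
rewrite pmulrn; apply: bitbound_int; rewrite ger0_norm //.
have : (k.+1 <= 2 ^ k.+1)%N by exact: ltnW (ltn_expl _ _).
by rewrite -(ler_nat int) natrX -natr1 natz.
Qed.

Lemma bitbound_exp2 (k : nat) : bitbound k.+1 (2 ^+ k).
Proof.
rewrite -[2]/(2%:~R) -rmorphXn; apply: bitbound_int.
rewrite ger0_norm ?exprn_ge0 // exprS mulrDl mul1r lerD2l.
by rewrite exprn_ege1.
Qed.

Lemma zsize_le (z : int) s : `|z| + 1 <= 2 ^+ s -> (zsize z <= s.+1)%N.
Proof.
move=> h; rewrite /zsize add1n ltnS; apply: up_log_min => //.
by rewrite -(ler_nat int) natrX -natr1 natz abszE.
Qed.

(** The numerator [a * denq a] may need [s + s] bits, hence the factor 3. With [bitbound_qsize] in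
    the other direction, the two measures agree up to constants. *)
Lemma qsize_le s a : bitbound s a -> (qsize a <= 3 * s + 3)%N.
Proof.
move=> /andP[d n]; rewrite /qsize.
have d1 : 1 <= (denq a)%:~R :> rat by rewrite ler1z -gtz0_ge1 denq_gt0.
have h1 : (zsize (numq a) <= (s + s).+1)%N.
  apply: zsize_le; rewrite -(ler_int rat) intrD intr_norm -mul_denq normrM.
  rewrite -[`|_%:~R|]intr_norm (gtr0_norm (denq_gt0 a)) rmorphXn /= exprD.
  have := normr_ge0 a; nra.
have h2 : (zsize (denq a) <= s.+2)%N.
  apply: zsize_le; rewrite -(ler_int rat) intrD intr_norm rmorphXn /=.
  rewrite -[`|_%:~R|]intr_norm (gtr0_norm (denq_gt0 a)).
  rewrite exprS; lra.
lia.
Qed.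

Lemma bitbound_qsize a : bitbound (qsize a) a.
Proof.
have up (z : int) : `|z|%:~R + 1 <= 2 ^+ zsize z :> rat.
  rewrite -[`|z|%R]abszE -pmulrn -natrX natr1 ler_nat.
  apply: leq_trans (up_logP _ (isT : 1 < 2)%N) _.
  by rewrite leq_exp2l // leqnSn.
have ge1 k : 1 <= 2 ^+ k :> rat by rewrite exprn_ege1.
have d1 : 1 <= (denq a)%:~R :> rat by rewrite ler1z -gtz0_ge1 denq_gt0.
have hn := up (numq a); have hd := up (denq a).
rewrite (gtr0_norm (denq_gt0 a)) in hd.
rewrite intr_norm -mul_denq normrM -[`|_%:~R|]intr_norm in hn.
rewrite (gtr0_norm (denq_gt0 a)) in hn.
rewrite /bitbound /qsize exprD.
have := ge1 (zsize (numq a)); have := ge1 (zsize (denq a)).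
by have := normr_ge0 a => *; apply/andP; split; nra.
Qed.

(** * Cost of the algorithm *)

(** A Hoare-style judgement for the cost monad: the postcondition carries the bit bounds of
    intermediate results to the operations that consume them. *)
Definition within T (bits calls : nat) (Q : T -> Prop) (c : Defs.comp T) :
    Prop :=
  [/\ (cbits c <= bits)%N, (ccalls c <= calls)%N & Q (cval c)].

Lemma within_ret T (Q : T -> Prop) v : Q v -> within 0 0 Q (ret v).
Proof. by []. Qed.

Lemma within_bind T U (Q : T -> Prop) (Q' : U -> Prop) b b' l l' c k :
  within b l Q c -> (forall v, Q v -> within b' l' Q' (k v)) ->
  within (b + b') (l + l') Q' (bind c k).
Proof.
move=> [h1 h2 h3] h; have [h1' h2' h3'] := h _ h3.
by split=> //=; apply: leq_add.
Qed.

Lemma within_le T (Q Q' : T -> Prop) b b' l l' c :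
  (b <= b')%N -> (l <= l')%N -> (forall v, Q v -> Q' v) ->
  within b l Q c -> within b' l' Q' c.
Proof.
move=> bb ll QQ [h1 h2 h3].
by split; [apply: leq_trans bb|apply: leq_trans ll|apply: QQ].
Qed.

(** The costs of the branches are added, not maximised, so that all bounds are sums and products, as
    the tactic [polyb] expects. *)
Lemma within_if T (Q : T -> Prop) b b' l (t : bool) (c c' : Defs.comp T) :
  (t -> within b l Q c) -> (~~ t -> within b' l Q c') ->
  within (b + b') l Q (if t then c else c').
Proof.
case: t => h h'.
  by apply: within_le (h isT); rewrite ?leq_addr.
by apply: within_le (h' isT); rewrite ?leq_addl.
Qed.

(** Operands of [s] and [t] bits have total [qsize] at most [3 * (s + t) + 6], so [opcost (s + t)]
    covers every binary operation, and [opcost s] every unary one. *)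
Definition opcost (s : nat) : nat := ((6 * s + 6) ^ 2)%N.

Lemma leq_opcost s t : (s <= t)%N -> (opcost s <= opcost t)%N.
Proof. by move=> st; rewrite leq_sqr; lia. Qed.

Lemma within_charge2 T (v : T) (Q : T -> Prop) s t a b :
  bitbound s a -> bitbound t b -> Q v ->
  within (opcost (s + t)) 0 Q (charge2 v a b).
Proof.
move=> /qsize_le ha /qsize_le hb hQ; split=> //=.
by rewrite leq_sqr; lia.
Qed.

Lemma within_charge1 T (v : T) (Q : T -> Prop) s a :
  bitbound s a -> Q v -> within (opcost s) 0 Q (charge1 v a).
Proof. by move=> /qsize_le ha hQ; split=> //=; rewrite leq_sqr; lia. Qed.

Lemma within_qadd s t a b : bitbound s a -> bitbound t b ->
  within (opcost (s + t)) 0 (bitbound (s + t)) (qadd a b).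
Proof. by move=> ha hb; apply: within_charge2 => //; exact: bitbound_add. Qed.

Lemma within_qsub s t a b : bitbound s a -> bitbound t b ->
  within (opcost (s + t)) 0 (bitbound (s + t)) (qsub a b).
Proof. by move=> ha hb; apply: within_charge2 => //; exact: bitbound_sub. Qed.

Lemma within_qmul s t a b : bitbound s a -> bitbound t b ->
  within (opcost (s + t)) 0 (bitbound (s + t)) (qmul a b).
Proof. by move=> ha hb; apply: within_charge2 => //; exact: bitbound_mul. Qed.

Lemma within_qdiv s t a b : bitbound s a -> bitbound t b ->
  within (opcost (s + t)) 0 (bitbound (s + (t + t).+1)) (qdiv a b).
Proof. by move=> ha hb; apply: within_charge2 => //; exact: bitbound_div. Qed.

Lemma within_qmax s t a b : bitbound s a -> bitbound t b ->
  within (opcost (s + t)) 0 (bitbound (s + t)) (qmax a b).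
Proof. by move=> ha hb; apply: within_charge2 => //; exact: bitbound_max. Qed.

Lemma within_qle s t a b : bitbound s a -> bitbound t b ->
  within (opcost (s + t)) 0 (fun _ => True) (qle a b).
Proof. by move=> ha hb; exact: within_charge2. Qed.

Lemma within_qeq s t a b : bitbound s a -> bitbound t b ->
  within (opcost (s + t)) 0 (fun _ => True) (qeq a b).
Proof. by move=> ha hb; exact: within_charge2. Qed.

Lemma within_qopp s a : bitbound s a ->
  within (opcost s) 0 (bitbound s) (qopp a).
Proof. by move=> ha; apply: within_charge1 => //; rewrite bitbound_opp. Qed.

Lemma within_qabs s a : bitbound s a ->
  within (opcost s) 0 (bitbound s) (qabs a).
Proof. by move=> ha; apply: within_charge1 => //; exact: bitbound_norm. Qed.

Lemma within_qceil s a : bitbound s a ->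
  within (opcost s) 0 (bitbound s.+1) (qceil a).
Proof. by move=> ha; apply: within_charge1 => //; exact: bitbound_ceil. Qed.

Lemma within_nsucc s k : (k <= s)%N ->
  within (opcost s.+1) 0 (fun k' => k' = k.+1) (nsucc k).
Proof.
move=> ks; apply: within_charge1 => //.
by apply: bitbound_le (bitbound_nat k); rewrite ltnS.
Qed.

Lemma within_cfun n T (Q : T -> Prop) b s (g : 'I_n -> Defs.comp T) :
  (n <= s)%N -> (forall i, within b 0 Q (g i)) ->
  within (s * b) 0 (fun v => forall i, Q (v i)) (cfun g).
Proof.
move=> ns h; split=> /=; last by move=> i; case: (h i).
  apply: (@leq_trans (\sum_(i < n) b)).
    by apply: leq_sum => i _; case: (h i).
  by rewrite sum_nat_const card_ord leq_mul2r ns orbT.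
by rewrite leqn0 sum_nat_eq0; apply/forallP=> i; case: (h i); rewrite leqn0.
Qed.

Lemma within_cvec n (Q : rat -> Prop) b s (g : 'I_n -> Defs.comp rat) :
  (n <= s)%N -> (forall i, within b 0 Q (g i)) ->
  within (s * b) 0 (fun v : 'cV_n => forall i, Q (v i 0)) (cvec g).
Proof.
move=> ns h; rewrite -[(s * b)%N]addn0; apply: within_bind (within_cfun ns h) _.
by move=> v hv; apply: within_ret => i; rewrite mxE.
Qed.

Lemma within_cmat m n (Q : rat -> Prop) b s
    (g : 'I_m -> 'I_n -> Defs.comp rat) :
  (m <= s)%N -> (n <= s)%N -> (forall i j, within b 0 Q (g i j)) ->
  within (s * (s * b)) 0 (fun v : 'M_(m, n) => forall i j, Q (v i j)) (cmat g).
Proof.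
move=> ms ns h; rewrite -[(s * (s * b))%N]addn0.
apply: within_bind (within_cfun ms (fun i => within_cfun ns (h i))) _.
by move=> v hv; apply: within_ret => i j; rewrite mxE.
Qed.

Lemma within_cvec_opt n (Q : rat -> Prop) b s
    (g : 'I_n -> Defs.comp (option rat)) :
  (n <= s)%N ->
  (forall i, within b 0 (fun o => forall r, o = Some r -> Q r) (g i)) ->
  within (s * b) 0
    (fun o => forall v : 'cV_n, o = Some v -> forall i, Q (v i 0)) (cvec_opt g).
Proof.
move=> ns h; rewrite -[(s * b)%N]addn0; apply: within_bind (within_cfun ns h) _.
move=> v hv; apply: within_ret => w; case: ifP => // /forallP vs [<-] i.
by rewrite mxE; case: (v i) (vs i) (hv i) => // r _; exact.
Qed.

(** Common to sums and maxima: the accumulator grows by the [t] bits of one entry per round, so [s]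
    entries lead to [s * t] bits. *)
Lemma within_fold n s t b (f : rat -> rat -> Defs.comp rat)
    (g : 'I_n -> Defs.comp rat) :
  (n <= s)%N -> (forall i, within b 0 (bitbound t) (g i)) ->
  (forall u x y, bitbound t x -> bitbound u y ->
    within (opcost (t + u)) 0 (bitbound (t + u)) (f x y)) ->
  within (s * (b + opcost (s * t))) 0 (bitbound (s * t))
    (foldr (fun i c => let* u := c in let* v := g i in f v u)
      (ret 0) (enum 'I_n)).
Proof.
move=> ns hg hf.
pose F e := foldr (fun i c => let* u := c in let* v := g i in f v u) (ret 0) e.
have main e : (size e <= s)%N ->
    within (size e * (b + opcost (s * t))) 0 (bitbound (size e * t)) (F e).
  elim: e => [|i e IH] /= es; first by split=> //=; exact: bitbound0.
  rewrite !mulSn addnC -[X in within _ X]/(0 + (0 + 0))%N.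
  apply: within_bind (IH (ltnW es)) _ => v hv.
  apply: within_bind (hg i) _ => w hw.
  apply: within_le (hf _ _ _ hw hv) => //; apply: leq_opcost.
  by rewrite -mulSn leq_mul2r es orbT.
apply: within_le (main (enum 'I_n) _); rewrite ?size_enum_ord //.
  by rewrite leq_mul2r ns orbT.
by move=> v; apply: bitbound_le; rewrite leq_mul2r ns orbT.
Qed.

Lemma within_csum n s t b (g : 'I_n -> Defs.comp rat) :
  (n <= s)%N -> (forall i, within b 0 (bitbound t) (g i)) ->
  within (s * (b + opcost (s * t))) 0 (bitbound (s * t)) (csum g).
Proof.
by move=> ns h; apply: within_fold => // u x y hx hy; exact: within_qadd.
Qed.

Lemma within_cmax n s t b (g : 'I_n -> Defs.comp rat) :
  (n <= s)%N -> (forall i, within b 0 (bitbound t) (g i)) ->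
  within (s * (b + opcost (s * t))) 0 (bitbound (s * t)) (cmax g).
Proof.
by move=> ns h; apply: within_fold => // u x y hx hy; exact: within_qmax.
Qed.

Lemma within_cforall n s b (g : 'I_n -> Defs.comp bool) :
  (n <= s)%N -> (forall i, within b 0 (fun _ => True) (g i)) ->
  within (s * b) 0 (fun _ => True) (cforall g).
Proof.
move=> ns hg; apply: (@within_le _ (fun _ => True) _ (n * b) _ 0) => //.
  by rewrite leq_mul2r ns orbT.
rewrite /cforall -{1}(size_enum_ord n).
elim: (enum 'I_n) => [|i e IH] //=; rewrite mulSn addnC -[0%N]/(0 + (0 + 0))%N.
apply: within_bind IH _ => v _; rewrite -[b]addn0.
by apply: within_bind (hg i) _ => w _; exact: within_ret.
Qed.

Lemma within_residual m n s t (A : 'M_(m, n)) (b : 'cV_m) (x : 'cV_n) :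
  (m <= s)%N -> (n <= s)%N -> (forall i j, bitbound t (A i j)) ->
  (forall j, bitbound t (b j 0)) -> (forall i, bitbound t (x i 0)) ->
  within (s * (s * (opcost (t + t) + opcost (s * (t + t))) +
               opcost (t + s * (t + t)))) 0
    (fun r : 'cV_m => forall j, bitbound (t + s * (t + t)) (r j 0))
    (residual A b x).
Proof.
move=> ms ns hA hb hx.
apply: (within_cvec (Q := bitbound (t + s * (t + t)))) => // j.
rewrite -[X in within _ X]/(0 + 0)%N.
apply: within_bind (within_csum ns _) _ => [i|v hv].
  by apply: within_qmul.
exact: within_qsub.
Qed.

(** Here the continuation keeps the exact value [v], as the analysis of Euclid's algorithm requires,
    and each operation is charged at one common width [w]. *)
Lemma within_bind2 T U (v : T) (k : T -> Defs.comp U) Q b l s t w x y :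
  bitbound s x -> bitbound t y -> (s + t <= w)%N -> within b l Q (k v) ->
  within (opcost w + b) l Q (bind (charge2 v x y) k).
Proof.
move=> hx hy /leq_opcost st h; apply: (within_bind (l := 0)).
  exact: within_le st (leqnn _) (fun v h => h) (within_charge2 hx hy (erefl v)).
by move=> _ <-.
Qed.

Lemma within_bind1 T U (v : T) (k : T -> Defs.comp U) Q b l s w x :
  bitbound s x -> (s <= w)%N -> within b l Q (k v) ->
  within (opcost w + b) l Q (bind (charge1 v x) k).
Proof.
move=> hx /leq_opcost st h; apply: (within_bind (l := 0)).
  exact: within_le st (leqnn _) (fun v h => h) (within_charge1 hx (erefl v)).
by move=> _ <-.
Qed.

Lemma within_qpow s a k : bitbound s a ->
  within (k * opcost (k * s + s).+1) 0 (bitbound (k * s).+1) (qpow a k).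
Proof.
move=> ha; elim: k => [|k IH]; first by split=> //; exact: bitbound1.
rewrite mulSn addnC -[X in within _ X]/(0 + 0)%N.
apply: (within_bind (Q := bitbound (k * s).+1)).
  by apply: within_le IH => //; rewrite leq_mul2l leq_opcost ?orbT //; lia.
move=> v hv; apply: within_le (within_qmul ha hv) => //; last first.
  by move=> w; rewrite addnS mulSn.
by apply: leq_opcost; lia.
Qed.

Lemma bitbound2 : bitbound 2 2.
Proof. exact: (@bitbound_int 2 2). Qed.

Lemma within_pow2_up fuel s t a D : bitbound s a -> bitbound t D ->
  within (3 * fuel * opcost (s + t + 2 * fuel + 2)) 0
    (bitbound (t + 2 * fuel)) (pow2_up fuel a D).
Proof.
move=> ha; elim: fuel t D => [|fuel IH] t D hD.
  by apply: within_ret; rewrite addn0.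
rewrite /=; set W := (s + t + _ + 2)%N; apply: within_le; last first.
- apply: (within_bind2 (w := W) ha hD); first by lia.
  apply: (within_bind2 (w := W) bitbound1 (bitbound_mul ha hD)); first by lia.
  apply: within_if => h.
    apply: (within_ret (Q := bitbound (t + 2 * fuel.+1))).
    by apply: bitbound_le hD; lia.
  apply: (within_bind2 (w := W) bitbound2 hD); first by lia.
  apply: within_le (leqnn _) (leqnn _) _ (IH _ _ (bitbound_mul bitbound2 hD)).
  by move=> v; apply: bitbound_le; lia.
- by [].
- by [].
- have -> : (s + (2 + t) + 2 * fuel + 2 = W)%N by rewrite /W; lia.
  by move: (opcost W) => c; nia.
Qed.

Lemma within_pow2_down fuel s t a D : bitbound s a -> bitbound t D ->
  within (3 * fuel * opcost (s + t + 5 * fuel + 1)) 0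
    (bitbound (t + 5 * fuel)) (pow2_down fuel a D).
Proof.
move=> ha; elim: fuel t D => [|fuel IH] t D hD.
  by apply: within_ret; rewrite addn0.
have hD' : bitbound (t + 5) (D / 2) := bitbound_div hD bitbound2.
rewrite /=; set W := (s + t + _ + 1)%N; apply: within_le; last first.
- apply: (within_bind2 (w := W) hD bitbound2); first by lia.
  apply: (within_bind2 (w := W) ha hD'); first by lia.
  apply: (within_bind2 (w := W) bitbound1 (bitbound_mul ha hD')); first by lia.
  apply: within_if => h.
    apply: within_le (leqnn _) (leqnn _) _ (IH _ _ hD').
    by move=> v; apply: (bitbound_le (t := t + 5 * fuel.+1)); lia.
  apply: (within_ret (Q := bitbound (t + 5 * fuel.+1))).
  by apply: bitbound_le hD; lia.
- by [].
- by [].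
- have -> : (s + (t + 5) + 5 * fuel + 1 = W)%N by rewrite /W; lia.
  by move: (opcost W) => c; nia.
Qed.

(** Both loops run for at most [qsize a <= 3 * s + 3] rounds, starting from one bit; a halving adds
    5 bits, which gives [1 + 5 * (3 * s + 3)], and a doubling adds only 2. *)
Lemma within_scale_factor s a : bitbound s a ->
  within (opcost s.+1 + 18 * (s + 1) * opcost (16 * s + 18)) 0
    (bitbound (15 * s + 16)) (scale_factor a).
Proof.
move=> ha; have hq := qsize_le ha.
have le (u v w z : nat) : (u <= v -> w <= z -> u * opcost w <= v * opcost z)%N.
  by move=> uv wz; rewrite leq_mul // leq_opcost.
rewrite /scale_factor; apply: (within_bind2 (w := s.+1) bitbound1 ha) => //.
apply: within_le; last first.
- apply: within_if => _.
    apply: within_le _ (leqnn 0) _ (within_pow2_down (qsize a) ha bitbound1).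
      by apply: (le _ (9 * (s + 1)) _ (16 * s + 18))%N; lia.
    by move=> v; apply: (bitbound_le (t := 15 * s + 16)); lia.
  apply: within_le _ (leqnn 0) _ (within_pow2_up (qsize a) ha bitbound1).
    by apply: (le _ (9 * (s + 1)) _ (16 * s + 18))%N; lia.
  by move=> v; apply: (bitbound_le (t := 15 * s + 16)); lia.
- by [].
- by [].
- lia.
Qed.

(** * Cost of rational reconstruction by Euclid's algorithm *)

(** The 17 operations include both branches of the closeness test. The widest operand is 4 times
    [M2] times the squared error [h - a * k], where the error has [3 * U] bits. *)
Lemma within_convergents_step U fuel (M2 a x h1 k1 h0 k0 : rat) b :
  let t : rat := (Num.floor x)%:~R in
  let Q := fun o : option rat => forall r, o = Some r ->
    bitbound (3 * U + 1) r in
  bitbound U M2 -> bitbound U a -> bitbound U x ->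
  bitbound U h1 -> bitbound U k1 -> bitbound U h0 -> bitbound U k0 ->
  bitbound U (t * h1 + h0) -> bitbound U (t * k1 + k0) ->
  (x - t != 0 -> within b 0 Q
    (convergents fuel M2 a (1 / (x - t)) (t * h1 + h0) (t * k1 + k0) h1 k1)) ->
  within (17 * opcost (7 * U + 5) + b) 0 Q
    (convergents fuel.+1 M2 a x h1 k1 h0 k0).
Proof.
move=> t Q hM ha hx hh1 hk1 hh0 hk0 hh hk hrec.
have b4 : bitbound 3 4 by apply: (@bitbound_int 3 4).
have ht : bitbound U.+1 t := bitbound_floor hx.
have he := bitbound_sub hh (bitbound_mul ha hk).
have hMe := bitbound_mul hM (bitbound_mul he he).
rewrite /=; apply: within_le; last first.
- apply: (within_bind1 (w := 7 * U + 5) hx); first by clear; lia.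
  apply: (within_bind2 (w := 7 * U + 5) ht hh1); first by clear; lia.
  apply: (within_bind2 (w := 7 * U + 5) (bitbound_mul ht hh1) hh0).
    by clear; lia.
  apply: (within_bind2 (w := 7 * U + 5) ht hk1); first by clear; lia.
  apply: (within_bind2 (w := 7 * U + 5) (bitbound_mul ht hk1) hk0).
    by clear; lia.
  apply: (within_bind2 (w := 7 * U + 5) hk hk); first by clear; lia.
  apply: (within_bind2 (w := 7 * U + 5) (bitbound_mul hk hk) hM).
    by clear; lia.
  apply: within_if => [_|_]; last exact: (within_ret (Q := Q)).
  apply: (within_bind2 (w := 7 * U + 5) ha hk); first by clear; lia.
  apply: (within_bind2 (w := 7 * U + 5) hh (bitbound_mul ha hk)).
    by clear; lia.
  apply: (within_bind2 (w := 7 * U + 5) he he); first by clear; lia.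
  apply: (within_bind2 (w := 7 * U + 5) hM (bitbound_mul he he)).
    by clear; lia.
  apply: (within_bind2 (w := 7 * U + 5) b4 hMe); first by clear; lia.
  apply: (within_bind2 (w := 7 * U + 5) (bitbound_mul b4 hMe) bitbound1).
    by clear; lia.
  apply: within_if => [_|_].
    apply: (within_bind2 (w := 7 * U + 5) hh hk); first by clear; lia.
    apply: (within_ret (Q := Q)) => r [<-].
    by apply: bitbound_le (bitbound_div hh hk); clear; lia.
  apply: (within_bind2 (w := 7 * U + 5) hx ht); first by clear; lia.
  apply: (within_bind2 (w := 7 * U + 5) (bitbound_sub hx ht) (bitbound0 0)).
    by clear; lia.
  apply: within_if => [_|y0]; first exact: (within_ret (Q := Q)).
  apply: (within_bind2 (w := 7 * U + 5) bitbound1 (bitbound_sub hx ht)).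
    by clear; lia.
  exact: hrec.
- by [].
- by [].
- by move: (opcost _) => c; clear; lia.
Qed.

(* N / D is the current complete quotient.  Every step of Euclid's algorithm *)
(* at least halves N * D, and the invariant denq a = k1 * N + k0 * D bounds  *)
(* the denominators of the convergents by that of a.                         *)
Lemma within_convergents U j fuel (M2 a : rat) (h1 k1 h0 k0 N D : int) :
  let Q := fun o : option rat => forall r, o = Some r ->
    bitbound (3 * U + 1) r in
  bitbound U M2 -> bitbound U a ->
  `|a| * (denq a)%:~R + 2 <= 2 ^+ U -> (denq a)%:~R + 1 <= 2 ^+ U :> rat ->
  0 < D <= N -> N * D < 2 ^+ j -> 0 < k1 -> 0 <= k0 ->
  denq a = k1 * N + k0 * D ->
  h0%:~R - a * k0%:~R = - (N%:~R / D%:~R) * (h1%:~R - a * k1%:~R) ->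
  `|h1%:~R - a * k1%:~R| <= 1 -> `|h0%:~R - a * k0%:~R| <= 1 ->
  within (j * (17 * opcost (7 * U + 5))) 0 Q
    (convergents fuel M2 a (N%:~R / D%:~R) h1%:~R k1%:~R h0%:~R k0%:~R).
Proof.
move=> Q hM ha aU dU.
elim: fuel j h1 k1 h0 k0 N D => [|fuel IH] j h1 k1 h0 k0 N D.
  by move=> *; split=> //=.
move=> /andP[D0 DN] Pj k1_gt0 k0_ge0 dE lin e1 e0.
have [j0|j0] := posnP j.
  by move: Pj; rewrite j0 expr0; nia.
(* A convergent with [|h - a * k| <= 1] has a numerator of at most [|a| * k + 1], so a bound on [k]
   bounds both numbers. *)
have small (h k : int) : 0 <= k -> k <= denq a ->
    `|h%:~R - a * k%:~R| <= 1 -> bitbound U h%:~R /\ bitbound U k%:~R.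
  move=> k00 kd he; have kd' : k%:~R <= (denq a)%:~R :> rat by rewrite ler_int.
  have k0' : 0 <= k%:~R :> rat by rewrite ler0z.
  split; apply: bitbound_int;
    rewrite -(ler_int rat) intrD intr_norm rmorphXn /=.
    apply: le_trans aU.
    have : `|h%:~R| <= `|a * k%:~R| + 1.
      apply: le_trans (_ : `|a * k%:~R + (h%:~R - a * k%:~R)| <= _).
        by rewrite addrC subrK.
      by apply: le_trans (ler_normD _ _) _; rewrite lerD2l.
    rewrite normrM (ger0_norm k0').
    have := normr_ge0 a; nra.
  by apply: le_trans dU; rewrite lerD2r ger0_norm.
have N0 : 0 < N by exact: lt_le_trans DN.
have Nd : N <= denq a by rewrite dE; move: N0 D0 k1_gt0 k0_ge0; clear; nia.
have [bh1 bk1] : bitbound U h1%:~R /\ bitbound U k1%:~R.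
  apply: small => //; first exact: ltW.
  by rewrite dE; move: N0 D0 k1_gt0 k0_ge0; clear; nia.
have [bh0 bk0] : bitbound U h0%:~R /\ bitbound U k0%:~R.
  apply: small => //.
  by rewrite dE; move: N0 D0 k1_gt0 k0_ge0; clear; nia.
have D0r : 0 < D%:~R :> rat by rewrite ltr0z.
have N0r : 0 < N%:~R :> rat by rewrite ltr0z.
have Ndr : N%:~R <= (denq a)%:~R :> rat by rewrite ler_int.
have DNr : D%:~R <= N%:~R :> rat by rewrite ler_int.
have D1r : 1 <= D%:~R :> rat by rewrite ler1z -gtz0_ge1.
have bx : bitbound U (N%:~R / D%:~R).
  apply: (bitboundP D0); first by rewrite divfK ?intr_int ?gt_eqF.
    by lra.
  rewrite ger0_norm; last by rewrite divr_ge0 // ltW.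
  apply: le_trans dU; rewrite lerD2r.
  by apply: le_trans Ndr; rewrite ler_pdivrMr // ler_peMr // ltW.
set x := N%:~R / D%:~R in lin bx *.
pose t := Num.floor x; pose r := N - t * D.
have /andP[t1 t2] := floor_itv x; rewrite -/t intrD in t1 t2.
have xt : x - t%:~R = r%:~R / D%:~R.
  by rewrite /r intrB intrM mulrBl mulfK // gt_eqF.
have r0 : 0 <= r.
  rewrite -(ler_int rat) -(pmulr_lge0 _ (x := D%:~R^-1)) ?invr_gt0 //.
  by rewrite -xt subr_ge0.
have rD : r < D.
  rewrite -(ltr_int rat) -[X in _ < X]mul1r -ltr_pdivrMr // -xt.
  by rewrite ltrBlDl.
have tge1 : 1 <= t by rewrite floor_ge_int ler_pdivlMr // mul1r.
have NE : N = t * D + r by rewrite /r addrC subrK.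
(* The error shrinks by the factor [r / D < 1] and therefore stays at most 1. *)
have eE : (t * h1 + h0)%:~R - a * (t * k1 + k0)%:~R =
    - (r%:~R / D%:~R) * (h1%:~R - a * k1%:~R).
  rewrite -xt !intrD !intrM.
  transitivity (t%:~R * (h1%:~R - a * k1%:~R) + (h0%:~R - a * k0%:~R)).
    by ring.
  by rewrite lin; ring.
have k_gt0 : 0 < t * k1 + k0.
  by move: tge1 k1_gt0 k0_ge0; clear; nia.
have dE' : denq a = (t * k1 + k0) * D + k1 * r by rewrite dE NE; ring.
have e_le1 : `|(t * h1 + h0)%:~R - a * (t * k1 + k0)%:~R| <= 1.
  have rD0 : 0 <= r%:~R / D%:~R :> rat by rewrite -xt subr_ge0.
  rewrite eE normrM normrN (ger0_norm rD0); apply: mulr_ile1 => //.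
  by rewrite -xt lerBlDl ltW.
have [bh bk] : bitbound U (t * h1 + h0)%:~R /\ bitbound U (t * k1 + k0)%:~R.
  apply: small => //; first exact: ltW.
  by rewrite dE'; move: D0 r0 k1_gt0 k_gt0; clear; move: (_ + _); nia.
rewrite -(prednK j0) mulSn.
have EH : (t * h1 + h0)%:~R = t%:~R * h1%:~R + h0%:~R :> rat.
  by rewrite intrD intrM.
have EK : (t * k1 + k0)%:~R = t%:~R * k1%:~R + k0%:~R :> rat.
  by rewrite intrD intrM.
apply: within_convergents_step => //; rewrite -/t -?EH -?EK // => xt0.
have r_gt0 : 0 < r.
  rewrite lt_neqAle r0 andbT; apply: contraNneq xt0 => E.
  by rewrite xt -E mul0r.
have -> : 1 / (x - t%:~R) = D%:~R / r%:~R by rewrite xt div1r invf_div.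
have r0r : r%:~R != 0 :> rat by rewrite intr_eq0 gt_eqF.
apply: IH => //.
- by rewrite r_gt0 ltW.
(* From [N = t * D + r] with [t >= 1] and [r < D] follows [2 * r < N], hence
   [2 * (D * r) < N * D]. *)
- move: Pj; rewrite -{1}(prednK j0) exprS {1}NE.
  by move: rD r0 tge1 D0 (2 ^+ _) {+}NE; clear; nia.
- by rewrite ltW.
- rewrite eE !mulNr mulrN opprK mulrA mulf_div [X in X / _]mulrC.
  by rewrite divff ?mul1r // mulf_neq0 // gt_eqF.
Qed.

(** The fuel exceeds the denominator of [a] and may be exponential in [s]; the bound comes from the
    halving in [within_convergents] instead. The first step is split off because the invariant needs
    [D <= N] and [0 < k1]; after it, [N * D < denq a ^+ 2 <= 2 ^+ (2 * s)]. *)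
Lemma within_round_to_denom s (a M2 : rat) :
  bitbound s a -> bitbound s M2 ->
  within ((2 * s + 1) * (17 * opcost (14 * s + 19))) 0
    (fun o => forall r, o = Some r -> bitbound (6 * s + 7) r)
    (round_to_denom a M2).
Proof.
move=> ha hM; have /andP[d n] := ha; set U := (2 * s + 2)%N.
have s1 : 1 <= 2 ^+ s :> rat by rewrite exprn_ege1.
have UE : 2 ^+ U = 4 * (2 ^+ s * 2 ^+ s) :> rat.
  by rewrite /U exprD mul2n -addnn exprD -natrX mulrC.
have a0 := normr_ge0 a.
have d1 : 1 <= (denq a)%:~R :> rat by rewrite ler1z -gtz0_ge1 denq_gt0.
have aU : `|a| * (denq a)%:~R + 2 <= 2 ^+ U by rewrite UE; nra.
have dU : (denq a)%:~R + 1 <= 2 ^+ U :> rat by rewrite UE; nra.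
have up x : bitbound s x -> bitbound U x.
  by apply: bitbound_le; rewrite /U; clear; lia.
pose t := Num.floor a.
have /andP[t1 t2] := floor_itv a; rewrite -/t intrD in t1 t2.
have ht : bitbound U t%:~R.
  by apply: bitbound_le (bitbound_floor ha); rewrite /U; clear; lia.
have h1 : bitbound U 1 by apply: bitbound_le bitbound1; rewrite /U; clear; lia.
have h0 : bitbound U 0 by exact: bitbound0.
pose r := numq a - t * denq a.
have d0 : 0 < (denq a)%:~R :> rat by rewrite ltr0z denq_gt0.
have at_ : a - t%:~R = r%:~R / (denq a)%:~R.
  by rewrite /r intrB intrM -mul_denq -mulrBl mulfK // gt_eqF.
have r0 : 0 <= r.
  rewrite -(ler_int rat) -(pmulr_lge0 _ (x := (denq a)%:~R^-1)) ?invr_gt0 //.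
  by rewrite -at_ subr_ge0.
have rD : r < denq a.
  rewrite -(ltr_int rat) -[X in _ < X]mul1r -ltr_pdivrMr // -at_.
  by rewrite ltrBlDl.
rewrite mulnDl mul1n addnC.
have UE' : (14 * s + 19 = 7 * U + 5)%N by rewrite /U; clear; lia.
rewrite UE' (_ : 6 * s + 7 = 3 * U + 1)%N; last by rewrite /U; clear; lia.
apply: within_convergents_step; rewrite -/t ?mulr1 ?mulr0 ?addr0 ?add0r //;
  try exact: up.
move=> nz; have r_gt0 : 0 < r.
  rewrite lt_neqAle r0 andbT; apply: contraNneq nz => E.
  by rewrite at_ -E mul0r.
have -> : 1 / (a - t%:~R) = (denq a)%:~R / r%:~R by rewrite at_ div1r invf_div.
have r0r : r%:~R != 0 :> rat by rewrite intr_eq0 gt_eqF.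
apply: (@within_convergents U _ _ _ _ t 1 1 0) => //.
- exact: up.
- exact: up.
- by rewrite r_gt0 ltW.
- rewrite mul2n -addnn exprD -(ltr_int rat) !intrM !rmorphXn /=.
  have : r%:~R < (denq a)%:~R :> rat by rewrite ltr_int.
  nra.
- by rewrite mul1r mul0r addr0.
- rewrite mulr0 mulr1 subr0 -[t%:~R - a]opprB at_ mulrNN mulf_div.
  by rewrite [X in X / _]mulrC divff // mulf_neq0 // gt_eqF.
- by rewrite mulr1 ler_norml; lra.
- by rewrite mulr0 subr0 normr1.
Qed.

(** * Functions with polynomial upper bounds *)

(** Natural coefficients make the bounding polynomials monotone ([leq_horner]), on which closure
    under composition rests. *)
Definition polyb (f : nat -> nat) : Prop :=
  exists P : {poly nat}, forall s, (f s <= P.[s])%N.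

Lemma polyb_const c : polyb (fun _ => c).
Proof. by exists c%:P => s; rewrite hornerC. Qed.

Lemma polyb_id : polyb id.
Proof. by exists 'X => s; rewrite hornerX. Qed.

Lemma polyb_add f g :
  polyb f -> polyb g -> polyb (fun s => f s + g s)%N.
Proof.
by move=> [P hP] [Q hQ]; exists (P + Q) => s; rewrite hornerD; exact: leq_add.
Qed.

Lemma polyb_mul f g :
  polyb f -> polyb g -> polyb (fun s => f s * g s)%N.
Proof.
by move=> [P hP] [Q hQ]; exists (P * Q) => s; rewrite hornerM; exact: leq_mul.
Qed.

Lemma polyb_S f : polyb f -> polyb (fun s => (f s).+1).
Proof.
move=> hf; have [P hP] := polyb_add hf (polyb_const 1).
by exists P => s; rewrite -addn1.
Qed.

Lemma leq_horner (P : {poly nat}) (s t : nat) :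
  (s <= t)%N -> (P.[s] <= P.[t])%N.
Proof.
move=> st; rewrite !horner_coef.
apply: (big_ind2 (fun u v : nat => u <= v)%N) => //.
  by move=> ? ? ? ? ? ?; exact: leq_add.
move=> i _; rewrite leq_mul2l; apply/orP; right.
have E (x : nat) (n : nat) : (x ^+ n)%R = (x ^ n)%N.
  by elim: n => // n IH; rewrite exprS expnS IH.
by rewrite !E; case: (nat_of_ord i) => // e; rewrite leq_exp2r.
Qed.

Lemma polyb_comp f g : polyb f -> polyb g -> polyb (fun s => f (g s)).
Proof.
move=> [P hP] [Q hQ]; exists (P \Po Q) => s; rewrite horner_comp.
exact: leq_trans (hP _) (leq_horner _ (hQ s)).
Qed.

Ltac polyb := repeat first
  [ assumption
  | apply: polyb_const
  | apply: polyb_id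
  | lazymatch goal with
    | |- polyb (fun s => (@?f s + @?g s)%N) => apply: (@polyb_add f g)
    | |- polyb (fun s => (@?f s * @?g s)%N) => apply: (@polyb_mul f g)
    | |- polyb (fun s => (@?f s).+1) => apply: (@polyb_S f)
    | |- polyb (fun s => opcost (@?f s)) => apply: (@polyb_comp opcost f)
    | h : polyb ?f |- polyb (fun s => ?f (@?g s)) => apply: (@polyb_comp f g h)
    end ].

Lemma polyb_opcost : polyb opcost.
Proof.
apply: (@polyb_mul (fun s => 6 * s + 6)%N (fun s => 6 * s + 6)%N); polyb.
Qed.

(** * Cost of one pass through the loop *)

Lemma within_qround s p a : (p <= s)%N -> bitbound s a ->
  within (6 * opcost (7 * s + 6)) 0 (fun _ => True) (qround p a).
Proof.
move=> ps ha; set W := (7 * s + 6)%N.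
have h2p : bitbound s.+1 (2 ^+ p).
  by apply: bitbound_le (bitbound_exp2 p); rewrite ltnS.
have h2pp : bitbound (2 * s).+1 (2 ^+ (2 * p)).
  by apply: bitbound_le (bitbound_exp2 _); rewrite ltnS leq_mul2l.
have hn : bitbound (2 * s).+1 (- 2 ^+ (2 * p)) by rewrite bitbound_opp.
have hh : bitbound 1 2^-1 by [].
have h1 := bitbound_mul ha h2p; have h2' := bitbound_add h1 hh.
have h3 := bitbound_floor h2'; have h4 := bitbound_min h2pp h3.
have h5 := bitbound_max hn h4.
apply: (within_le (Q := fun=> True)); last first.
- apply: (within_bind2 (w := W) ha h2p); first by rewrite /W; clear; lia.
  apply: (within_bind2 (w := W) h1 hh); first by rewrite /W; clear; lia.
  apply: (within_bind1 (w := W) h2'); first by rewrite /W; clear; lia.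
  apply: (within_bind2 (w := W) h2pp h3); first by rewrite /W; clear; lia.
  apply: (within_bind2 (w := W) hn h4); first by rewrite /W; clear; lia.
  apply: (within_le (b' := opcost W) _ (leqnn 0) _ (within_qdiv h5 h2p)) => //.
  by apply: leq_opcost; rewrite /W; clear; lia.
- by [].
- by [].
- by move: (opcost W) => c; clear; lia.
Qed.

Lemma within_call_oracle s O p m n (L : lp m n) :
  (p <= s)%N -> (m <= s)%N -> (n <= s)%N ->
  (forall i j, bitbound s (lpA L i j)) -> (forall j, bitbound s (lpb L j 0)) ->
  (forall i, bitbound s (lpc L i 0)) -> (forall i, bitbound s (lpl L i 0)) ->
  within (s * (s * (6 * opcost (7 * s + 6))) +
          3 * (s * (6 * opcost (7 * s + 6)))) 1
    (fun o => o = cval (call_oracle O p L)) (call_oracle O p L).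
Proof.
move=> ps ms ns hA hb hc hl.
have hO (o : option (answer m n)) : within 0 1 (fun=> True) (Comp o 0 1).
  by split.
suff [h1 h2 _] : within (s * (s * (6 * opcost (7 * s + 6))) +
    3 * (s * (6 * opcost (7 * s + 6)))) 1 (fun _ => True) (call_oracle O p L).
  by split.
apply: (within_le (Q := fun=> True)); last first.
- apply: (within_bind (Q := fun _ => True)) => [|A _].
    apply: within_le (leqnn _) (leqnn _) _
      (within_cmat ms ns (fun i j => within_qround ps (hA i j))) => //.
  apply: (within_bind (Q := fun _ => True)) => [|b _].
    apply: within_le (leqnn _) (leqnn _) _
      (within_cvec ms (fun i => within_qround ps (hb i))) => //.
  apply: (within_bind (Q := fun _ => True)) => [|c _].
    apply: within_le (leqnn _) (leqnn _) _
      (within_cvec ns (fun i => within_qround ps (hc i))) => //.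
  apply: (within_bind (Q := fun _ => True)) => [|l _].
    apply: within_le (leqnn _) (leqnn _) _
      (within_cvec ns (fun i => within_qround ps (hl i))) => //.
  exact: hO.
- by [].
- by [].
- by move: (s * (6 * _))%N (s * (s * _))%N => c c2; clear; lia.
Qed.

Definition lp_bitbound (s m n : nat) (L : lp m n) : Prop :=
  [/\ (m <= s)%N /\ (n <= s)%N, forall i j, bitbound s (lpA L i j),
      forall j, bitbound s (lpb L j 0), forall i, bitbound s (lpc L i 0)
    & forall i, bitbound s (lpl L i 0)].

Definition vec_bitbound (s n : nat) (x : 'cV[rat]_n) : Prop :=
  forall i, bitbound s (x i 0).

Lemma lp_bitbound_le s t m n (L : lp m n) :
  (s <= t)%N -> lp_bitbound s L -> lp_bitbound t L.
Proof.
move=> st [[ms ns] hA hb hc hl]; have up a := @bitbound_le s t a st.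
split=> [|i j|j|i|i]; try exact: up.
by split; exact: leq_trans st.
Qed.

Lemma within_some T U (o : option T) Q b b' l (f : T -> Defs.comp U) c :
  (forall v, o = Some v -> within b l Q (f v)) -> within b' l Q c ->
  within (b + b') l Q (if o is Some v then f v else c).
Proof.
case: o => [v|] hf hc.
  by apply: within_le (leq_addr _ _) (leqnn _) _ (hf v erefl).
by apply: within_le (leq_addl _ _) (leqnn _) _ hc.
Qed.

(** Here and below, the bound is an existential variable that the cost derivation fills in. It may
    depend on [s] only and is shown to be polynomial afterwards by the tactic [polyb]. *)
Lemma within_check_primal : exists2 B : nat -> nat, polyb B &
  forall s m n (L : lp m n) x, lp_bitbound s L -> vec_bitbound s x ->
  within (B s) 0 (fun=> True) (check_primal L x).
Proof.
eexists (fun s => _); last first.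
  move=> s m n L x [[ms ns] hA hb hc hl] hx.
  apply: (within_bind (l := 0) (l' := 0)) (within_residual ms ns hA hb hx) _.
  move=> r hr; apply: (within_bind (l := 0) (l' := 0)).
    apply: within_cforall ms _ => j.
    exact: within_qeq (hr j) (bitbound0 0).
  move=> eqs _; apply: (within_bind (l := 0) (l' := 0)).
    by apply: within_cforall ns _ => j; exact: within_qle (hl j) (hx j).
  by move=> bds _; exact: within_ret.
have h := polyb_opcost; polyb.
Qed.

Lemma within_check_optimal : exists2 B : nat -> nat, polyb B &
  forall s m n (L : lp m n) x y, lp_bitbound s L ->
  vec_bitbound s x -> vec_bitbound s y ->
  within (B s) 0 (fun=> True) (check_optimal L x y).
Proof.
have [B0 pB0 hB0] := within_check_primal.
eexists (fun s => _); last first.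
  move=> s m n L x y hL hx hy; have [[ms ns] hA hb hc hl] := hL.
  apply: (within_bind (l := 0) (l' := 0)) (hB0 _ _ _ _ _ hL hx) _ => pf _.
  have hA' i j : bitbound s ((lpA L)^T i j) by rewrite mxE.
  apply: (within_bind (l := 0) (l' := 0)) (within_residual ns ms hA' hc hy) _.
  move=> r hr; apply: (within_bind (l := 0) (l' := 0)).
    apply: within_cforall ns _ => i.
    exact: within_qle (bitbound0 0) (hr i).
  move=> df _; apply: (within_bind (l := 0) (l' := 0)).
    apply: within_csum ns _ => i.
    apply: (within_bind (l := 0) (l' := 0)) (within_qsub (hx i) (hl i)) _.
    by move=> u hu; exact: within_qmul hu (hr i).
  move=> gap hgap; apply: (within_bind (l := 0) (l' := 0)).
    exact: within_qeq hgap (bitbound0 0).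
  by move=> cs _; exact: within_ret.
have h := polyb_opcost; polyb.
Qed.

Lemma within_reconstruct : exists2 B : nat -> nat, polyb B &
  forall s P m n (L : lp m n) k D x y, lp_bitbound s L -> (k <= s)%N ->
  bitbound s (par_beta P) -> bitbound s D ->
  vec_bitbound s x -> vec_bitbound s y ->
  within (B s) 0 (fun=> True) (reconstruct P L k D x y).
Proof.
have [B1 pB1 hB1] := within_check_primal.
have [B2 pB2 hB2] := within_check_optimal.
have hop := polyb_opcost.
eexists (fun s => _); last first.
  move=> s P m n L k D x y hL ks hbeta hD hx hy.
  have [[ms ns] hA hb hc hl] := hL.
  pose u := (2 * (s * s) + s + 7)%N; pose v := (6 * u + 7)%N.
  have su : (s <= u)%N by rewrite /u; clear; nia.
  have sv : (s <= v)%N by apply: leq_trans su _; rewrite /v; clear; lia.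
  have hLv := lp_bitbound_le sv hL.
  apply: (within_bind (Q := bitbound (s * s).+1) (l := 0) (l' := 0)
    (b := s * opcost (s * s + s).+1)).
    apply: within_le (within_qpow k hbeta) => //.
      by rewrite leq_mul // leq_opcost // ltnS leq_add2r leq_mul2r ks orbT.
    by move=> z; apply: bitbound_le; rewrite ltnS leq_mul2r ks orbT.
  move=> bk hbk; apply: (within_bind (l := 0) (l' := 0)).
    exact: within_qmul bitbound2 hbk.
  move=> d hd; apply: (within_bind (Q := bitbound u) (l := 0) (l' := 0)).
    apply: within_le (leqnn _) _ _ (within_qdiv hD hd) => // z.
    by apply: bitbound_le; rewrite /u; clear; lia.
  move=> M2 hM2; apply: (within_bind (l := 0) (l' := 0)).
    apply: within_cvec_opt ns _ => i.
    apply: within_round_to_denom hM2; exact: bitbound_le su (hx i).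
  move=> ox hox; apply: within_some; last exact: within_ret.
  move=> xs /hox {}hox.
  apply: (within_bind (l := 0) (l' := 0)) (hB1 v _ _ _ _ hLv hox) _ => feas _.
  apply: within_if => _; last exact: within_ret.
  apply: (within_bind (l := 0) (l' := 0)).
    apply: within_cvec_opt ms _ => j.
    apply: within_round_to_denom hM2; exact: bitbound_le su (hy j).
  move=> oy hoy; apply: within_some; last exact: within_ret.
  move=> ys /hoy {}hoy.
  apply: (within_bind (l := 0) (l' := 0)) (hB2 v _ _ _ _ _ hLv hox hoy) _.
  by move=> opt _; exact: within_ret.
polyb.
Qed.

Lemma bitbound_if (t : bool) s u a b :
  bitbound s a -> bitbound u b -> bitbound (s + u) (if t then a else b).
Proof.
move=> ha hb; case: t; [apply: bitbound_le ha|apply: bitbound_le hb].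
  exact: leq_addr.
exact: leq_addl.
Qed.

(** Separate sizes for the parts of the LP let unification read off the bound of each scaled
    residual vector. *)
Lemma within_sized_oracle_call : exists2 B : nat -> nat, polyb B &
  forall s t u v (O : oracle) p m n (A : 'M_(m, n)) b c l,
  (p <= s)%N -> (m <= s)%N -> (n <= s)%N ->
  (forall i j, bitbound s (A i j)) -> vec_bitbound t b -> vec_bitbound u c ->
  vec_bitbound v l ->
  within (B (s + t + u + v)%N) 1 (fun o => o = O m n (round_lp p (LP A b c l)))
    (call_oracle O p (LP A b c l)).
Proof.
eexists (fun s => _); last first.
  move=> s t u v O p m n A b c l ps ms ns hA hb hc hl.
  set w := (s + t + u + v)%N.
  have [sw tw uw vw] : [/\ s <= w, t <= w, u <= w & v <= w]%N.
    by rewrite /w; clear; split; lia.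
  rewrite -[O m n _]cval_call_oracle.
  apply: (within_call_oracle (s := w)); rewrite /= ?(leq_trans _ sw) //.
  - by move=> i j; exact: bitbound_le sw (hA i j).
  - by move=> i; exact: bitbound_le tw (hb i).
  - by move=> i; exact: bitbound_le uw (hc i).
  - by move=> i; exact: bitbound_le vw (hl i).
have h := polyb_opcost; polyb.
Qed.

(** The hypothesis on the oracle's answers is restricted to LPs with the matrix of [L], for which
    the full row rank that its guarantee presupposes is available. *)
Lemma within_step : exists2 B : nat -> nat, polyb B &
  forall s O P m n (L : lp m n) k kstar D x y, lp_bitbound s L -> (k <= s)%N ->
  (par_p P <= s)%N -> bitbound s (par_alpha P)%:R ->
  bitbound s (par_beta P) -> bitbound s (par_f P) ->
  bitbound s kstar -> bitbound s D -> vec_bitbound s x -> vec_bitbound s y ->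
  (forall (L' : lp m n) xh yh Bh, lpA L' = lpA L ->
    O m n (round_lp (par_p P) L') = Some (Answer xh yh Bh) ->
    vec_bitbound s xh /\ vec_bitbound s yh) ->
  within (B s) 1 (fun=> True) (step O P L (State k kstar D x y)).
Proof.
have [B1 pB1 hB1] := within_reconstruct.
have [B2 pB2 hB2] := within_sized_oracle_call.
have hop := polyb_opcost.
have hB1' s t P m n (L : lp m n) k D x y : lp_bitbound s L -> (k <= s)%N ->
    bitbound s (par_beta P) -> bitbound t D ->
    vec_bitbound s x -> vec_bitbound s y ->
    within (B1 (s + t)%N) 0 (fun=> True) (reconstruct P L k D x y).
  move=> hL ks hbeta hD hx hy; have st := leq_addr t s.
  apply: hB1; first exact: lp_bitbound_le st hL.
  - exact: leq_trans st.
  - exact: bitbound_le st hbeta.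
  - by apply: bitbound_le hD; rewrite leq_addl.
  - by move=> i; exact: bitbound_le st (hx i).
  - by move=> i; exact: bitbound_le st (hy i).
eexists (fun s => _); last first.
  move=> s O P m n L k kstar D x y hL ks ps halpha hbeta hf hks hD hx hy hO.
  have [[ms ns] hA hb hc hl] := hL.
  have hA' i j : bitbound s ((lpA L)^T i j) by rewrite mxE.
  have hk : bitbound s.+1 k%:R.
    by apply: bitbound_le (bitbound_nat k); rewrite ltnS.
  rewrite /step.
  apply: (within_bind (l := 0) (l' := 1)) (within_residual ms ns hA hb hx) _.
  move=> bh hbh; apply: (within_bind (l := 0) (l' := 1)).
    by apply: within_cvec ns _ => i; exact: within_qsub (hl i) (hx i).
  move=> lh hlh.
  apply: (within_bind (l := 0) (l' := 1)) (within_residual ns ms hA' hc hy) _.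
  move=> ch hch; apply: (within_bind (l := 0) (l' := 1)).
    by apply: within_cmax ms _ => j; exact: within_qabs (hbh j).
  move=> vb hvb; apply: (within_bind (l := 0) (l' := 1)).
    by apply: within_cmax ns _ => i; exact: within_ret (hlh i).
  move=> vl hvl; apply: (within_bind (l := 0) (l' := 1)).
    by apply: within_cmax ns _ => i; exact: within_qopp (hch i).
  move=> vc hvc; apply: (within_bind (l := 0) (l' := 1)).
    apply: within_csum ns _ => i.
    apply: (within_bind (l := 0) (l' := 0)) (within_qopp (hlh i)) _ => t ht.
    exact: within_qmul ht (hch i).
  move=> sg /within_qabs hsg; apply: (within_bind (l := 0) (l' := 1)) hsg _.
  move=> gap hgap.
  apply: (within_bind (l := 0) (l' := 1)) (within_qmax hvb hvl) _ => v hv.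
  apply: (within_bind (l := 0) (l' := 1)) (within_qmax hv hvc) _ => w hw.
  apply: (within_bind (l := 0) (l' := 1)) (within_qmax hw hgap) _ => de hde.
  apply: (within_bind (l := 0) (l' := 1)) (within_qeq hde (bitbound0 0)) _.
  move=> don _; apply: (within_if (l := 1)).
    by move=> _; apply: within_le (leqnn 0) (leq0n 1) _ (within_ret _).
  move=> _.
  apply: (within_bind (l := 0) (l' := 1)) (within_qmul halpha hD) _ => aD haD.
  apply: (within_bind (l := 0) (l' := 1)) (within_qdiv bitbound1 haD) _.
  move=> lim hlim.
  have hfl := bitbound_if (par_gap P) hde hw.
  apply: (within_bind (l := 0) (l' := 1)) (within_qmax hfl hlim) _ => de' hde'.
  apply: (within_bind (l := 0) (l' := 1)) (within_scale_factor hde') _.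
  move=> D' hD'.
  apply: (within_bind (l := 0) (l' := 1)) (within_qle hks hk) _ => try _.
  apply: (within_bind (Q := fun=> True) (l := 0) (l' := 1)).
    apply: within_if => _; last exact: within_ret.
    exact: hB1' hL ks hbeta hD' hx hy.
  move=> res _; apply: within_some => [[xs ys] _|].
    by apply: within_le (leqnn 0) (leq0n 1) _ (within_ret _).
  apply: (within_bind (Q := fun=> True) (l := 0) (l' := 1)).
    apply: within_if => _; last exact: within_ret.
    apply: (within_bind (l := 0) (l' := 0)) (within_qmul hf hk) _ => fk hfk.
    apply: within_le (leqnn _) (leqnn 0) _ (within_qceil hfk) => //.
  move=> kstar' _; apply: (within_bind (l := 0) (l' := 1)).
    by apply: within_cvec ms _ => j; exact: within_qmul hD' (hbh j).
  move=> bs hbs; apply: (within_bind (l := 0) (l' := 1)).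
    by apply: within_cvec ns _ => i; exact: within_qmul hD' (hch i).
  move=> cs hcs; apply: (within_bind (l := 0) (l' := 1)).
    by apply: within_cvec ns _ => i; exact: within_qmul hD' (hlh i).
  move=> ls hls.
  apply: (within_bind (l := 1) (l' := 0))
    (hB2 _ _ _ _ O _ _ _ _ _ _ _ ps ms ns hA hbs hcs hls) _.
  move=> oa hoa; apply: within_some; last exact: within_ret.
  move=> [xh yh Bh] oaE.
  have [hxh hyh] : vec_bitbound s xh /\ vec_bitbound s yh.
    by apply: hO (_ : _ = Some (Answer xh yh Bh)); last by rewrite -oaE hoa.
  apply: (within_bind (l := 0) (l' := 0)).
    apply: within_cvec ns _ => i.
    apply: (within_bind (l := 0) (l' := 0)) (within_qdiv (hxh i) hD') _ => t ht.
    exact: within_qadd (hx i) ht.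
  move=> x' _; apply: (within_bind (l := 0) (l' := 0)).
    apply: within_cvec ms _ => j.
    apply: (within_bind (l := 0) (l' := 0)) (within_qdiv (hyh j) hD') _ => t ht.
    exact: within_qadd (hy j) ht.
  move=> y' _; apply: (within_bind (l := 0) (l' := 0)) (within_nsucc ks) _.
  by move=> k' _; exact: within_ret.
polyb.
Qed.

(** * Basic solutions *)

Lemma factorial_le_exp2 k : (k`! <= 2 ^ (k * k))%N.
Proof.
elim: k => // k IH; rewrite factS.
apply: leq_trans (leq_mul (ltnW (ltn_expl k.+1 (isT : 1 < 2)%N)) IH) _.
by rewrite -expnD leq_exp2l //; nia.
Qed.

(** Leibniz formula: there are [k! <= 2 ^ (s * s)] terms, each a product of [k <= s] entries. *)
Lemma det_norm_le s w k (M : 'M[rat]_k) : (k <= s)%N ->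
  (forall i j, `|M i j| <= 2 ^+ w) -> `|\det M| <= 2 ^+ (s * s + s * w).
Proof.
move=> ks hM; apply: le_trans (_ : \sum_(t : 'S_k) 2 ^+ (k * w) <= _).
  apply: le_trans (ler_norm_sum _ _ _) _; apply: ler_sum => t _.
  rewrite normrM normrX normrN1 expr1n mul1r normr_prod.
  rewrite mulnC exprM -[X in _ ^+ X](card_ord k) -prodr_const.
  by apply: ler_prod => i _; rewrite normr_ge0 hM.
rewrite sumr_const card_Sn -[X in X <= _]mulr_natl exprD.
apply: ler_pM; rewrite ?ler0n ?exprn_ge0 //; last first.
  by rewrite ler_eXn2l ?ltr1n // leq_mul.
rewrite -natrX ler_nat; apply: leq_trans (factorial_le_exp2 k) _.
by rewrite leq_exp2l // leq_mul.
Qed.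

Lemma det_int k (M : 'M[rat]_k) :
  (forall i j, M i j \is a Num.int) -> \det M \is a Num.int.
Proof.
move=> hM; apply: rpred_sum => t _; rewrite rpredMsign.
by apply: rpred_prod => i _.
Qed.

(** Cramer's rule for the integral matrix [M = d *: A]: the inverse of [A] is [d] times the adjugate
    of [M] over [\det M]. As a nonzero integer, [\det M] has absolute value at least 1 and does not
    enlarge the entries, and [q = |\det M|] clears their denominators. *)
Lemma inverse_bound s d k (A : 'M[rat]_k) : (k <= s)%N ->
  A \in unitmx -> (forall i j, `|A i j| <= 2 ^+ s) ->
  0 < d <= 2 ^+ s -> (forall i j, d * A i j \is a Num.int) ->
  d \is a Num.int ->
  exists N q, let V := (s + (s * s + s * (s + s)))%N in
  [/\ N *m A = 1%:M, A *m N = 1%:M,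
      0 < q <= 2 ^+ V, q \is a Num.int
    & forall i j, q * N i j \is a Num.int /\ `|N i j| <= 2 ^+ V].
Proof.
move=> ks uA hA /andP[d0 ds] dA dint; pose M := d *: A.
have uM : M \in unitmx by rewrite unitmxZ // unitfE gt_eqF.
have Mint i j : M i j \is a Num.int by rewrite mxE.
have Mle i j : `|M i j| <= 2 ^+ (s + s).
  by rewrite mxE normrM exprD gtr0_norm // ler_pM // ltW.
have D0 : \det M != 0 by rewrite -unitfE -unitmxE.
have D1 : 1 <= `|\det M| by apply: norm_intr_ge1; rewrite ?det_int.
have cofE i j : cofactor M i j \is a Num.int /\
    `|cofactor M i j| <= 2 ^+ (s * s + s * (s + s)).
  rewrite /cofactor rpredMsign normrM normrX normrN1 expr1n mul1r; split.
    by apply: det_int => a b; rewrite mxE mxE Mint.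
  apply: det_norm_le => [|a b]; first exact: leq_trans (leq_pred _) ks.
  by rewrite mxE mxE Mle.
exists (d *: invmx M), `|\det M| => V; split.
- by rewrite -scalemxAl scalemxAr mulVmx.
- by rewrite -scalemxAr scalemxAl mulmxV.
- rewrite normr_gt0 D0; apply: le_trans (det_norm_le ks Mle) _.
  by rewrite ler_eXn2l ?ltr1n // leq_addl.
- by case: ger0P => _; rewrite ?rpredN det_int.
- move=> i j; have [c1 c2] := cofE j i.
  rewrite /invmx uM !mxE; split.
    have -> : `|\det M| * (d * ((\det M)^-1 * cofactor M j i)) =
        (-1) ^+ (\det M < 0)%R * (d * cofactor M j i).
      rewrite {1}[`|_|]normrEsign -!mulrA; congr (_ * _).
      by rewrite mulrCA mulVKf.
    by rewrite rpredMsign rpredM.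
  rewrite normrM (gtr0_norm d0) normrM normfV [X in _ <= X]exprD.
  apply: ler_pM => //.
  - exact: ltW.
  - by rewrite mulr_ge0 // invr_ge0.
  - apply: le_trans c2; rewrite mulrC ler_pdivrMr ?normr_gt0 //.
    by rewrite ler_peMr.
Qed.

(** Enumerating [B] makes its columns a square matrix, and a kernel vector of that matrix would be a
    linear dependency of the columns. *)
Lemma basis_columns m n (A : 'M[rat]_(m, n)) (B : {set 'I_n}) :
  is_basis A B -> exists g : 'I_m -> 'I_n,
  [/\ injective g, B = [set g t | t : 'I_m]
    & \matrix_(j, t) A j (g t) \in unitmx].
Proof.
move=> /andP[/eqP cB]; move: A; case: m / cB => A frB.
exists enum_val; split.
- exact: enum_val_inj.
- apply/setP=> i; apply/idP/imsetP => [iB|[t _ ->]]; last exact: enum_valP.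
  by exists (enum_rank_in iB i); rewrite ?enum_rankK_in.
rewrite unitmxE unitfE -det_tr; apply/det0P=> -[v v0 vA].
move/negP: v0; apply; apply/eqP/matrixP=> i t; rewrite (ord1 i) [RHS]mxE.
move: t; pose X := map_tuple (fun i => col i A) (enum_tuple B).
apply: (elimT (@freeP _ _ _ X) frB (v 0)).
apply/matrixP=> j k; rewrite [RHS]mxE summxE.
transitivity ((v *m (\matrix_(j, t) A j (enum_val t))^T) 0 j); last first.
  by rewrite vA mxE.
rewrite mxE; apply: eq_bigr => t _; rewrite !mxE.
rewrite (nth_map (enum_val t)) -?cardE // mxE.
by rewrite -enum_val_nth.
Qed.

(** The oracle's guarantee with rational tolerances and without the membership in [limited p], which
    would not survive scaling back. *)
Definition accurate (e g : rat) m n (L : lp m n) (x : 'cV[rat]_n)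
    (y : 'cV[rat]_m) (B : {set 'I_n}) : Prop :=
  let r := lpc L - (lpA L)^T *m y in
  [/\ is_basis (lpA L) B,
      [/\ forall j, `|(lpA L *m x - lpb L) j 0| <= e,
          forall i, lpl L i 0 - e <= x i 0
        & forall i, - e <= r i 0],
      `|((x - lpl L)^T *m r) 0 0| <= g
    & (forall i, i \notin B -> `|(x - lpl L) i 0| <= e) /\
      (forall i, i \in B -> `|r i 0| <= e)].

Definition clears_denominators (s : nat) (d : rat) m n (L : lp m n) : Prop :=
  [/\ 0 < d <= 2 ^+ s, d \is a Num.int,
      forall i j, `|lpA L i j| <= 2 ^+ s /\ d * lpA L i j \is a Num.int,
      forall j, d * lpb L j 0 \is a Num.int
    & forall i, d * lpc L i 0 \is a Num.int /\ d * lpl L i 0 \is a Num.int].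

Lemma sum_norm_le n (F : 'I_n -> rat) (s : nat) (e : rat) :
  (n <= s)%N -> 0 <= e -> (forall i, `|F i| <= e) ->
  forall P : pred 'I_n, `|\sum_(i | P i) F i| <= 2 ^+ s * e.
Proof.
move=> ns e0 hF P; apply: le_trans (ler_norm_sum _ _ _) _.
apply: le_trans (_ : \sum_(i < n) e <= _).
  rewrite big_mkcond; apply: ler_sum => i _.
  by case: ifP => _; [exact: hF|exact: e0].
rewrite sumr_const card_ord -[X in X <= _]mulr_natl ler_wpM2r // -natrX ler_nat.
exact: leq_trans ns (ltnW (ltn_expl _ _)).
Qed.

(* By Cramer's rule and the Leibniz formula, the entries of the inverse of  *)
(* the basis matrix have numerators and denominators of at most 2 ^+ E.  So *)
(* the exact basic solution of B has a common denominator Q of this size    *)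
(* and is E bits less accurate than x, y.                                   *)
Lemma basic_solution s d m n (L : lp m n) e g x y B :
  (m <= s)%N -> (n <= s)%N -> clears_denominators s d L -> 0 <= e ->
  accurate e g L x y B ->
  let E := (s + (s * s + s * (s + s)) + 3 * s + 1)%N in
  exists Q xs ys, let r := lpc L - (lpA L)^T *m y in
    let rs := lpc L - (lpA L)^T *m ys in
  [/\ 0 < Q <= 2 ^+ E /\ Q \is a Num.int, lpA L *m xs = lpb L,
      forall i, xs i 0 = lpl L i 0 \/ rs i 0 = 0,
      [/\ forall i, Q * xs i 0 \is a Num.int,
          forall j, Q * ys j 0 \is a Num.int,
          forall i, Q * (xs i 0 - lpl L i 0) \is a Num.int
        & forall i, Q * rs i 0 \is a Num.int]
    & [/\ forall i, `|xs i 0 - x i 0| <= 2 ^+ E * e,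
          forall j, `|ys j 0 - y j 0| <= 2 ^+ E * e
        & forall i, `|rs i 0 - r i 0| <= 2 ^+ E * e]].
Proof.
move=> ms ns [/andP[d0 ds] dint hA hb hcl] e0 [hB [h1 h2 h3] h4 [h5 h6]] E.
have [gB [ginj BE unitB]] := basis_columns hB.
set AB := (\matrix_(j, t) _) in unitB.
have ABle j t : `|AB j t| <= 2 ^+ s by rewrite mxE; case: (hA j (gB t)).
have ABint j t : d * AB j t \is a Num.int by rewrite mxE; case: (hA j (gB t)).
have [|N [q [NA AN /andP[q0 qV] qint hN]]] :=
  inverse_bound ms unitB ABle _ ABint dint; first by rewrite d0.
set V := (s + _)%N in qV hN.
have splitB (F : 'I_n -> rat) :
    \sum_i F i = \sum_(i | i \notin B) F i + \sum_t F (gB t).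
  rewrite (bigID (mem B)) /= addrC; congr (_ + _).
  rewrite {1}BE big_imset; first by apply: eq_bigl.
  by move=> a b _ _; exact: ginj.
pose be : 'cV[rat]_m :=
  \col_j (lpb L j 0 - \sum_(i | i \notin B) lpA L j i * lpl L i 0).
pose z := N *m be.
(* Nonbasic variables sit at their bounds; the sum selects the unique [t] with [gB t = i]. *)
pose xs : 'cV[rat]_n :=
  \col_i (if i \in B then \sum_(t | gB t == i) z t 0 else lpl L i 0).
pose cB : 'cV[rat]_m := \col_t lpc L (gB t) 0.
pose ys := N^T *m cB.
have gBB t : gB t \in B by rewrite BE; apply/imsetP; exists t.
have xsB t : xs (gB t) 0 = z t 0.
  by rewrite mxE gBB (big_pred1 t) // => u; rewrite (inj_eq ginj).
have xsN i : i \notin B -> xs i 0 = lpl L i 0 by rewrite mxE => /negbTE->.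
have ABz : AB *m z = be by rewrite mulmxA AN mul1mx.
have feas : lpA L *m xs = lpb L.
  apply/matrixP=> j k; rewrite (ord1 k) mxE splitB.
  under eq_bigr => i iB do rewrite xsN //.
  have -> : \sum_t lpA L j (gB t) * xs (gB t) 0 = be j 0.
    by rewrite -ABz mxE; apply: eq_bigr => t _; rewrite xsB [AB _ _]mxE.
  by rewrite mxE; ring.
have ABys : AB^T *m ys = cB by rewrite mulmxA -trmx_mul NA trmx1 mul1mx.
set rs := lpc L - (lpA L)^T *m ys; set r := lpc L - _ in h3 h4 h6.
have rsB t : rs (gB t) 0 = 0.
  have := congr1 (fun M : 'cV_m => M t 0) ABys.
  rewrite !mxE => <-; apply/eqP; rewrite subr_eq0; apply/eqP.
  by apply: eq_bigr => j _; rewrite !mxE.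
have EE : E = (V + (s + (s + s) + 1))%N by rewrite /E -/V; clear; lia.
have two k : 1 <= 2 ^+ k :> rat by rewrite exprn_ege1.
have zint t : q * (d * d) * z t 0 \is a Num.int.
  rewrite mxE mulr_sumr; apply: rpred_sum => j _.
  have -> : q * (d * d) * (N t j * be j 0) = q * N t j * (d * d * be j 0).
    by ring.
  rewrite rpredM //; first by case: (hN t j).
  rewrite mxE mulrBr -mulrA rpredB //; first by rewrite rpredM.
  rewrite mulr_sumr rpred_sum // => i _; rewrite mulrACA rpredM //.
    by case: (hA j i).
  by case: (hcl i).
have ysint j : q * d * ys j 0 \is a Num.int.
  rewrite mxE mulr_sumr; apply: rpred_sum => t _.
  have -> : q * d * (N^T j t * cB t 0) = q * N t j * (d * cB t 0).
    by rewrite [N^T _ _]mxE; ring.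
  rewrite rpredM //; first by case: (hN t j).
  by rewrite mxE; case: (hcl (gB t)).
(* [q] clears the inverse, and the powers of [d] clear the products of data entries, such as
   [lpA L j i * lpl L i 0], that it is multiplied with. *)
pose Q := q * (d * (d * d)).
have Ql i : Q * lpl L i 0 \is a Num.int.
  have -> : Q * lpl L i 0 = q * (d * d) * (d * lpl L i 0) by rewrite /Q; ring.
  by rewrite rpredM //; [rewrite !rpredM|case: (hcl i)].
have Qxs i : Q * xs i 0 \is a Num.int.
  have [|iB] := boolP (i \in B); last by rewrite xsN.
  rewrite {1}BE => /imsetP[t _ ->]; rewrite xsB.
  have -> : Q * z t 0 = d * (q * (d * d) * z t 0) by rewrite /Q; ring.
  by rewrite rpredM.
pose xB : 'cV[rat]_m := \col_t x (gB t) 0.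
(* The basis system is missed by the violation of the equations plus the nonbasic deviations
   weighted by matrix entries, at most [e + 2 ^+ s * (2 ^+ s * e)]. *)
have rho j : `|(be - AB *m xB) j 0| <= 2 ^+ (s + s + 1) * e.
  have -> : (be - AB *m xB) j 0 = - (lpA L *m x - lpb L) j 0 +
      \sum_(i | i \notin B) lpA L j i * (x - lpl L) i 0.
    have -> : \sum_(i | i \notin B) lpA L j i * (x - lpl L) i 0 =
        \sum_(i | i \notin B) lpA L j i * x i 0 -
        \sum_(i | i \notin B) lpA L j i * lpl L i 0.
      rewrite -sumrB; apply: eq_bigr => i _.
      by rewrite [(x - _) i 0]mxE [(- lpl L) i 0]mxE mulrBr.
    rewrite ![in LHS]mxE [in RHS]mxE [(- lpb L) j 0]mxE [(lpA L *m x) j 0]mxE.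
    rewrite splitB; have -> : \sum_t AB j t * xB t 0 =
        \sum_t lpA L j (gB t) * x (gB t) 0.
      by apply: eq_bigr => t _; rewrite !mxE.
    by ring.
  apply: le_trans (ler_normD _ _) _; rewrite normrN.
  have off : `|\sum_(i | i \notin B) lpA L j i * (x - lpl L) i 0| <=
      2 ^+ s * (2 ^+ s * e).
    rewrite big_mkcond; apply: (sum_norm_le ns) => [|i].
      by rewrite mulr_ge0 // exprn_ge0.
    case: ifP => iB; last by rewrite normr0 mulr_ge0 // exprn_ge0.
    by rewrite normrM ler_pM //; [case: (hA j i)|exact: h5].
  have -> : 2 ^+ (s + s + 1) * e =
      2 ^+ s * (2 ^+ s * e) + 2 ^+ s * (2 ^+ s * e).
    by rewrite addn1 exprS exprD; ring.
  apply: lerD off; apply: le_trans (h1 j) _; rewrite mulrA.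
  by rewrite ler_peMl // mulr_ege1.
(* Applying the inverse [N] adds [V + s] bits to the [s + s + 1] of [rho], which is how [E]
   arises. *)
have ex t : `|xs (gB t) 0 - x (gB t) 0| <= 2 ^+ E * e.
  have -> : xs (gB t) 0 - x (gB t) 0 = (N *m (be - AB *m xB)) t 0.
    by rewrite mulmxBr mulmxA NA mul1mx xsB -/z !mxE.
  rewrite mxE.
  have -> : 2 ^+ E * e = 2 ^+ s * (2 ^+ V * (2 ^+ (s + s + 1) * e)).
    by rewrite EE !exprD; ring.
  apply: (sum_norm_le ms) => [|j]; first by rewrite !mulr_ge0 ?exprn_ge0.
  by rewrite normrM ler_pM //; case: (hN t j).
have ey j : `|ys j 0 - y j 0| <= 2 ^+ (V + s) * e.
  have -> : ys j 0 - y j 0 = (N^T *m (cB - AB^T *m y)) j 0.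
    by rewrite mulmxBr mulmxA -trmx_mul AN trmx1 mul1mx -/ys !mxE.
  rewrite mxE (_ : _ * e = 2 ^+ s * (2 ^+ V * e)); last by rewrite exprD; ring.
  apply: (sum_norm_le ms) => [|t]; first by rewrite !mulr_ge0 ?exprn_ge0.
  rewrite normrM ler_pM //; first by rewrite mxE; case: (hN t j).
  rewrite (_ : (cB - AB^T *m y) t 0 = r (gB t) 0); first exact: h6.
  rewrite /r !mxE; congr (_ - _).
  by apply: eq_bigr => k _; rewrite !mxE.
have leE k : (k <= E)%N -> 2 ^+ k * e <= 2 ^+ E * e.
  by move=> kE; rewrite ler_wpM2r // ler_eXn2l ?ltr1n.
exists Q, xs, ys; split.
- split; last by rewrite !rpredM.
  rewrite !mulr_gt0 //= EE exprD ler_pM //; first exact: ltW.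
    by rewrite !mulr_ge0 // ltW.
  apply: le_trans (_ : 2 ^+ (s + (s + s)) <= _).
    by rewrite !exprD !ler_pM ?mulr_ge0 // ltW.
  by rewrite ler_eXn2l ?ltr1n // leq_addr.
- exact: feas.
- move=> i; have [|iB] := boolP (i \in B); last by left; exact: xsN.
  by rewrite {1}BE => /imsetP[t _ ->]; right; exact: rsB.
- split=> // [j|i|i].
  + have -> : Q * ys j 0 = d * d * (q * d * ys j 0) by rewrite /Q; ring.
    by rewrite rpredM // rpredM.
  + by rewrite mulrBr rpredB.
  + rewrite !mxE mulrBr rpredB //.
      have -> : Q * lpc L i 0 = q * (d * d) * (d * lpc L i 0).
        by rewrite /Q; ring.
      by rewrite rpredM //; [rewrite !rpredM|case: (hcl i)].
    rewrite mulr_sumr rpred_sum // => j _; rewrite [(lpA L)^T i j]mxE.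
    have -> : Q * (lpA L j i * ys j 0) = d * (d * lpA L j i) * (q * d * ys j 0).
      by rewrite /Q; ring.
    by rewrite rpredM // rpredM //; case: (hA j i).
split=> [i|j|i].
- have [|iB] := boolP (i \in B).
    by rewrite {1}BE => /imsetP[t _ ->]; exact: ex.
  rewrite xsN // distrC; have := h5 _ iB; rewrite !mxE => h.
  by apply: le_trans h _; rewrite -[X in X <= _]mul1r ler_wpM2r.
- by apply: le_trans (ey j) _; apply: leE; rewrite EE; clear; lia.
- have -> : rs i 0 - r i 0 = \sum_j (lpA L)^T i j * (y - ys) j 0.
    rewrite /rs /r.
    transitivity (((lpA L)^T *m (y - ys)) i 0); last by rewrite mxE.
    by rewrite mulmxBr !mxE; ring.
  apply: le_trans (leE (s + (s + (V + s)))%N _); last by rewrite EE; clear; lia.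
  rewrite exprD [2 ^+ (s + (V + s))]exprD -!mulrA.
  apply: (sum_norm_le ms) => [|j]; first by rewrite !mulr_ge0 ?exprn_ge0.
  rewrite normrM mxE [(y - ys) j 0]mxE [(- ys) j 0]mxE distrC.
  by rewrite ler_pM //; case: (hA j i).
Qed.

(** Slacks and reduced costs are within [T * e] of quantities that are at least [- e], hence above
    [- 1 / Q]; being multiples of [1 / Q], they are nonnegative. *)
Lemma basic_optimal m n (L : lp m n) (Q T e g : rat) xs ys x y B :
  let r := lpc L - (lpA L)^T *m y in let rs := lpc L - (lpA L)^T *m ys in
  accurate e g L x y B -> 0 < Q -> Q * (T * e + e) < 1 ->
  lpA L *m xs = lpb L -> (forall i, xs i 0 = lpl L i 0 \/ rs i 0 = 0) ->
  (forall i, Q * (xs i 0 - lpl L i 0) \is a Num.int) ->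
  (forall i, Q * rs i 0 \is a Num.int) ->
  (forall i, `|xs i 0 - x i 0| <= T * e) ->
  (forall i, `|rs i 0 - r i 0| <= T * e) ->
  optimal L xs ys.
Proof.
move=> r rs [_ [_ hx hr] _ _] Q0 Qe feas comp xint rint ex er.
have pos v w : Q * v \is a Num.int -> `|v - w| <= T * e -> - e <= w -> 0 <= v.
  move=> /intrP[u uE]; rewrite ler_norml => /andP[h1 _] h2.
  rewrite -(pmulr_rge0 _ Q0) uE ler0z leNgt; apply/negP => u0.
  have : u%:~R <= (-1)%:~R :> rat by rewrite ler_int; move: u0; clear; lia.
  rewrite -uE rmorphN1.
  have : Q * - (T * e + e) <= Q * v by rewrite ler_pM2l //; lra.
  by rewrite mulrN; lra.
split.
- split=> // i; rewrite -subr_ge0; apply: (pos _ (x i 0 - lpl L i 0)) => //.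
    by rewrite (_ : _ - _ = xs i 0 - x i 0) //; ring.
  by have := hx i; lra.
- by move=> i; apply: (pos _ (r i 0)) => //; exact: hr.
- rewrite mxE big1 // => i _; rewrite [(xs - _)^T _ _]mxE [(xs - _) _ _]mxE.
  rewrite [(- lpl L) _ _]mxE.
  have [->|] := comp i; first by rewrite subrr mul0r.
  by rewrite -/rs => ->; rewrite mulr0.
Qed.

(** * Reconstruction of the basic solution *)

Lemma round_to_denom_good a M2 u v :
  good_approx a M2 u v -> cval (round_to_denom a M2) = Some (u%:~R / v%:~R).
Proof.
move=> g; have [r' E] : exists r', cval (round_to_denom a M2) = Some r'.
  apply: (@convergents_complete _ M2 a u v a 1 0 0 1 (numq a) (denq a) g) => //.
  - by rewrite mulr1 mulr0 subr0 sub0r mulr1.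
  - by left.
  - by rewrite divq_num_den.
  - by have := denq_gt0 a; clear; lia.
rewrite E; congr Some.
have [||u' [v' [-> g']]] :=
  @convergents_sound `|denq a|.+1 M2 a a 1 0 0 1 r'; [by left|exact: E|].
exact: good_approx_unique g' g.
Qed.

(** The witness is [(Q * r) / Q], not necessarily in lowest terms; the condition on [e] is
    [e < 1 / (2 * M * Q)], squared to avoid the root [M] of [M2]. *)
Lemma round_to_denom_int a M2 Q r e : 0 < Q -> Q \is a Num.int ->
  Q * r \is a Num.int -> Q ^+ 2 <= M2 -> `|r - a| <= e ->
  4 * (M2 * (Q * e) ^+ 2) < 1 -> cval (round_to_denom a M2) = Some r.
Proof.
move=> Q0 /intrP[v vE] /intrP[u uE] QM re close.
have V0 : v%:~R != 0 :> rat by rewrite -vE gt_eqF.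
have e0 : 0 <= e by apply: le_trans re.
have -> : r = u%:~R / v%:~R by rewrite -uE -vE mulrC mulKf ?gt_eqF.
apply: round_to_denom_good; split; first by rewrite -(ltr0z rat) -vE.
  by rewrite -vE.
apply: le_lt_trans close; rewrite ler_pM2l // ler_wpM2l //.
  by apply: le_trans QM; exact: sqr_ge0.
rewrite -uE -vE -real_normK ?num_real // lerXn2r ?nnegrE //.
  by rewrite mulr_ge0 // ltW.
by rewrite [a * Q]mulrC -mulrBr normrM gtr0_norm // ler_pM2l.
Qed.

Lemma cval_bind T U (c : Defs.comp T) (k : T -> Defs.comp U) :
  cval (bind c k) = cval (k (cval c)).
Proof. by []. Qed.

Lemma cval_cvec n (g : 'I_n -> Defs.comp rat) :
  cval (cvec g) = \col_i cval (g i).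
Proof. by []. Qed.

Lemma cval_qpow a k : cval (qpow a k) = a ^+ k.
Proof. by elim: k => // k IH; rewrite exprS -IH. Qed.

Lemma cval_cvec_opt n (g : 'I_n -> Defs.comp (option rat)) (v : 'cV_n) :
  (forall i, cval (g i) = Some (v i 0)) -> cval (cvec_opt g) = Some v.
Proof.
move=> gv; rewrite /cvec_opt /=; case: ifP => [_|/negP[]].
  by congr Some; apply/matrixP=> i j; rewrite (ord1 j) mxE gv.
by apply/forallP => i; rewrite gv.
Qed.

Lemma reconstruct_optimal P m n (L : lp m n) k D x y xs ys :
  cval (reconstruct P L k D x y) = Some (xs, ys) -> optimal L xs ys.
Proof.
rewrite /reconstruct /=; case: ifP => //= _; case: ifP => //= _.
case: ifP => //= _; case: ifP => // h [<- <-].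
by apply/cval_check_optimalP; exact: h.
Qed.

Lemma reconstruct_some P m n (L : lp m n) k D (x xs : 'cV_n) (y ys : 'cV_m) :
  let M2 : rat := D / (2 * par_beta P ^+ k) in
  (forall i, cval (round_to_denom (x i 0) M2) = Some (xs i 0)) ->
  (forall j, cval (round_to_denom (y j 0) M2) = Some (ys j 0)) ->
  optimal L xs ys ->
  cval (reconstruct P L k D x y) = Some (xs, ys).
Proof.
move=> M2 hx hy opt; rewrite /M2 -cval_qpow in hx hy.
rewrite /reconstruct !cval_bind (cval_cvec_opt hx) cval_bind.
have -> : cval (check_primal L xs) by apply/cval_check_primalP; case: opt.
rewrite cval_bind (cval_cvec_opt hy) cval_bind.
by have -> : cval (check_optimal L xs ys) by apply/cval_check_optimalP.
Qed.

(** Denominator and error of the basic solution cost [E] bits each, hence the factors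
    [2 ^+ (2 * E)]. The same smallness of the error makes this solution optimal, so that it also
    passes the exact checks. *)
Lemma reconstruct_accurate s d P m n (L : lp m n) k D x y e g B :
  let E := (s + (s * s + s * (s + s)) + 3 * s + 1)%N in
  let M2 := D / (2 * par_beta P ^+ k) in
  (m <= s)%N -> (n <= s)%N -> clears_denominators s d L -> 0 <= e ->
  accurate e g L x y B ->
  2 ^+ (2 * E) <= M2 -> 4 * (M2 * (2 ^+ (2 * E) * e) ^+ 2) < 1 ->
  exists xs ys, cval (reconstruct P L k D x y) = Some (xs, ys).
Proof.
move=> E M2 ms ns sL e0 acc hM he.
have [Q [xs [ys [[/andP[Q0 QE] Qint] feas comp [ix iy il ir] [ex ey er]]]]] :=
  basic_solution ms ns sL e0 acc.
rewrite -/E in QE ex ey er.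
have two k' : 1 <= 2 ^+ k' :> rat by rewrite exprn_ege1.
have EE : 2 ^+ (2 * E) = 2 ^+ E * 2 ^+ E :> rat by rewrite mul2n -addnn exprD.
have QM : Q ^+ 2 <= M2.
  by apply: le_trans hM; rewrite EE expr2 ler_pM // ltW.
have Qe : 4 * (M2 * (Q * (2 ^+ E * e)) ^+ 2) < 1.
  apply: le_lt_trans he; rewrite ler_pM2l // ler_wpM2l //.
    by apply: le_trans hM; exact: exprn_ge0.
  have e1 : 0 <= 2 ^+ E * e by rewrite mulr_ge0 // exprn_ge0.
  rewrite lerXn2r ?nnegrE ?mulr_ge0 ?(ltW Q0) // ?EE ?mulr_ge0 ?exprn_ge0 //.
  by rewrite -mulrA ler_wpM2r.
exists xs, ys; apply: reconstruct_some.
- by move=> i; apply: (@round_to_denom_int _ _ Q _ (2 ^+ E * e)).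
- by move=> j; apply: (@round_to_denom_int _ _ Q _ (2 ^+ E * e)).
apply: (@basic_optimal _ _ L Q (2 ^+ E) e g xs ys x y B) => //.
have M1 : 1 <= M2 by apply: le_trans hM.
set w := 2 ^+ (2 * E) * e in he.
have w0 : 0 <= w by rewrite mulr_ge0 // exprn_ge0.
(* As [M2 >= 1], the condition for reconstruction already forces [w < 1 / 2]. *)
have w1 : 2 * w < 1.
  rewrite ltNge; apply/negP => w1; move: he; rewrite ltNge => /negP; apply.
  have : 1 <= (2 * w) ^+ 2 by rewrite expr2 mulr_ege1.
  have := sqr_ge0 w; rewrite !expr2; nra.
apply: le_lt_trans w1; rewrite /w EE.
have h : 2 ^+ E * e + e <= 2 * (2 ^+ E * e).
  have : e <= 2 ^+ E * e by rewrite ler_peMl.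
  lra.
apply: le_trans (_ : 2 ^+ E * (2 * (2 ^+ E * e)) <= _).
  apply: ler_pM => //; first exact: ltW.
  by rewrite addr_ge0 // mulr_ge0 // exprn_ge0.
by rewrite le_eqVlt; apply/orP; left; apply/eqP; ring.
Qed.

(** * Refinement steps *)

Definition violation m n (L : lp m n) (x : 'cV[rat]_n) (y : 'cV[rat]_m) : rat :=
  Num.max (Num.max (\big[Num.max/0]_j `|(lpb L - lpA L *m x) j 0|)
                   (\big[Num.max/0]_i (lpl L - x) i 0))
          (\big[Num.max/0]_i - (lpc L - (lpA L)^T *m y) i 0).

Definition duality_gap m n (L : lp m n) (x : 'cV[rat]_n) (y : 'cV[rat]_m) :
    rat :=
  `|((x - lpl L)^T *m (lpc L - (lpA L)^T *m y)) 0 0|.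

Definition scaled_residual m n (D : rat) (L : lp m n) (x : 'cV[rat]_n)
    (y : 'cV[rat]_m) : lp m n :=
  LP (lpA L) (D *: (lpb L - lpA L *m x)) (D *: (lpc L - (lpA L)^T *m y))
     (D *: (lpl L - x)).

Definition next_factor (P : params) m n (L : lp m n) (D : rat) x y : rat :=
  let viol := violation L x y in
  let delta := if par_gap P then Num.max viol (duality_gap L x y) else viol in
  cval (scale_factor (Num.max delta (1 / ((par_alpha P)%:R * D)))).

(** Strips the cost bookkeeping, so that correctness and termination can be argued on plain
    vectors. *)
Lemma cval_step O P m n (L : lp m n) k kstar D x y :
  let D' := next_factor P L D x y in let try := kstar <= k%:R in
  cval (step O P L (State k kstar D x y)) =
  if Num.max (violation L x y) (duality_gap L x y) == 0
  then inl (Returned x y) else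
  if (if try then cval (reconstruct P L k D' x y) else None) is Some (xs, ys)
  then inl (Returned xs ys) else
  if O m n (round_lp (par_p P) (scaled_residual D' L x y))
    is Some (Answer xh yh _) then
    inr (State k.+1 (if try then (Num.ceil (par_f P * k%:R))%:~R else kstar) D'
      (x + D'^-1 *: xh) (y + D'^-1 *: yh))
  else inl Aborted.
Proof.
move=> D' try.
have E2 : cval (cvec (fun i => qsub (lpl L i 0) (x i 0))) = lpl L - x.
  by apply/matrixP=> i j; rewrite (ord1 j) !mxE.
have Esum : cval (csum (fun i => let* t := qopp ((lpl L - x) i 0) in
    qmul t ((lpc L - (lpA L)^T *m y) i 0))) =
    ((x - lpl L)^T *m (lpc L - (lpA L)^T *m y)) 0 0.
  rewrite cval_csum [RHS]mxE; apply: eq_bigr => i _.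
  rewrite [LHS]/(- (lpl L - x) i 0 * _); congr (_ * _).
  by rewrite !mxE opprB.
rewrite /step cval_bind cval_residual cval_bind E2 cval_bind cval_residual.
rewrite !cval_bind Esum.
set w := (X in qmax X (cval (qabs _))).
have Ew : w = violation L x y.
  rewrite /w -[LHS]/(Num.max (Num.max (cval _) (cval _)) (cval _)).
  by rewrite !cval_cmax.
set de := (if par_gap P then _ else _).
have Ede : de = if par_gap P then Num.max (violation L x y) (duality_gap L x y)
                else violation L x y.
  by rewrite -Ew /de; case: (par_gap P).
rewrite Ew.
set c := (X in cval (if X then _ else _)).
have -> : c = (Num.max (violation L x y) (duality_gap L x y) == 0) by [].
case: (_ == 0) => //.  rewrite !cval_bind -/try.
have -> : cval (scale_factor (cval (qmax de (cval (qdiv 1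
    (cval (qmul (par_alpha P)%:R D))))))) = D' by rewrite Ede.
set c1 := cval (qle _ _); have -> : c1 = try by [].
rewrite (_ : cval (if try then reconstruct P L k D' x y else ret None) =
   if try then cval (reconstruct P L k D' x y) else None); last by case: try.
case: (if try then cval _ else None) => [[//]|].
rewrite 5!cval_bind.
have -> : cval (if try then let* fk := qmul (par_f P) k%:R in qceil fk
                else ret kstar) =
    if try then (Num.ceil (par_f P * k%:R))%:~R else kstar by case: try.
set cL := call_oracle _ _ _; have -> : cval cL =
    O m n (round_lp (par_p P) (scaled_residual D' L x y)).
  rewrite /cL cval_call_oracle !cval_cvec.
  congr (O m n (round_lp _ (LP _ _ _ _)));
    by apply/matrixP=> i j; rewrite (ord1 j) !mxE.
case: (O _ _ _) => [[xh yh Bh]|//].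
rewrite 3!cval_bind !cval_cvec; congr (inr (State _ _ _ _ _));
  by apply/matrixP=> i j; rewrite (ord1 j) !mxE /= mulrC.
Qed.

Lemma violation_ge0 m n (L : lp m n) x y : 0 <= violation L x y.
Proof. by rewrite /violation !le_max bigmax_idl le_max lexx. Qed.

Lemma violation_le e g m n (L : lp m n) x y B :
  0 <= e -> accurate e g L x y B -> violation L x y <= e.
Proof.
move=> e0 [_ [h1 h2 h3] _ _]; rewrite /violation !ge_max.
apply/andP; split; [apply/andP; split|]; apply: bigmax_le => // i _.
- by rewrite !mxE distrC; have := h1 i; rewrite !mxE.
- by have := h2 i; rewrite !mxE; lra.
- by rewrite lerNl.
Qed.

Lemma violation0_optimal m n (L : lp m n) x y :
  violation L x y = 0 -> duality_gap L x y = 0 -> optimal L x y.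
Proof.
move=> v0 /normr0_eq0 g0.
have : violation L x y <= 0 by rewrite v0.
rewrite /violation !ge_max => /andP[/andP[h1 h2] h3].
have le j (F : 'I_j -> rat) : \big[Num.max/0]_i F i <= 0 -> forall i, F i <= 0.
  by move=> h i; apply: le_trans h; exact: le_bigmax.
split=> //.
- split=> [|i]; last by have := le _ _ h2 i; rewrite !mxE subr_le0.
  apply/matrixP=> j k; rewrite (ord1 k); apply/eqP.
  have := le _ _ h1 j; rewrite normr_le0 => /eqP h; rewrite eq_sym -subr_eq0.
  by move/eqP: h; rewrite !mxE.
- by move=> i; have := le _ _ h3 i; rewrite oppr_le0.
Qed.

(** All residuals of the refined pair are those of the scaled problem divided by [D]; the gap is a
    product of two of them and gains the factor twice. *)
Lemma accurate_refine e g D m n (L : lp m n) x y xh yh B : 0 < D ->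
  accurate e g (scaled_residual D L x y) xh yh B ->
  accurate (e / D) (g / D ^+ 2) L (x + D^-1 *: xh) (y + D^-1 *: yh) B.
Proof.
move=> D0 []; rewrite /=; set A := lpA L.
set rh := _ - _ *m yh => hB [h1 h2 h3] h4 [h5 h6].
have nD : D != 0 by rewrite gt_eqF.
have E1 : A *m (x + D^-1 *: xh) - lpb L =
    D^-1 *: (A *m xh - D *: (lpb L - A *m x)).
  rewrite scalerBr scalerA mulVf // scale1r mulmxDr -scalemxAr.
  by rewrite opprB addrA; congr (_ - _); rewrite addrC.
have E2 : x + D^-1 *: xh - lpl L = D^-1 *: (xh - D *: (lpl L - x)).
  rewrite scalerBr scalerA mulVf // scale1r opprB addrA; congr (_ - _).
  by rewrite addrC.
have E3 : lpc L - A^T *m (y + D^-1 *: yh) = D^-1 *: rh.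
  rewrite /rh scalerBr scalerA mulVf // scale1r mulmxDr -scalemxAr.
  by rewrite opprD addrA.
have nrm (v : rat) c : `|v| <= c -> `|D^-1 * v| <= c / D.
  by move=> h; rewrite normrM gtr0_norm ?invr_gt0 // mulrC ler_pM2r ?invr_gt0.
split=> //; rewrite -/A ?E1 ?E2 ?E3.
- split=> i.
  + by rewrite mxE nrm.
  + have : - (e / D) <= (D^-1 *: (xh - D *: (lpl L - x))) i 0.
      rewrite mxE -mulNr mulrC ler_pM2l ?invr_gt0 //.
      by have := h2 i; rewrite !mxE; lra.
    by rewrite -E2 !mxE; lra.
  + by rewrite mxE -mulNr mulrC ler_pM2l ?invr_gt0.
- set u := xh - _ in h4 *; have -> : (D^-1 *: u)^T = D^-1 *: u^T.
    by apply/matrixP=> i j; rewrite !mxE.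
  rewrite -scalemxAl -scalemxAr scalerA mxE expr2 invfM normrM.
  rewrite ger0_norm ?mulr_ge0 ?invr_ge0 ?(ltW D0) // mulrC.
  by rewrite ler_wpM2r // mulr_ge0 // invr_ge0 ltW.
- by split=> i iB; rewrite mxE nrm //; [exact: h5|exact: h6].
Qed.

(* The gap is at most g / D ^+ 2, so once D is large it no longer limits    *)
(* the growth of the scaling factors, which then is 1 / e; before that the  *)
(* factors grow at least by 1 / th.                                         *)
Lemma next_factorP (P : params) (w d : nat) (e g th : rat) m n (L : lp m n)
    x y B :
  let D := 2 ^+ d in let D' := next_factor P L D x y in
  (2 <= par_alpha P)%N -> (par_alpha P)%:R^-1 <= e -> 0 < e ->
  e <= th -> 0 <= g -> (par_gap P -> g <= th) -> (2 * par_alpha P <= 2 ^ w)%N ->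
  th < 1 ->
  accurate (e / D) (g / D ^+ 2) L x y B ->
  [/\ exists2 d', D' = 2 ^+ d' & (d <= d' <= d + w)%N,
      D <= th * D', g <= e * D -> D <= e * D'
    & D' <= 2 * (par_alpha P)%:R * D].
Proof.
move=> D D' al2 ale e0 eth g0 gth hw th1 acc.
have D0 : 0 < D by exact: exprn_gt0.
have D1 : 1 <= D by exact: exprn_ege1.
have a0 : 0 < (par_alpha P)%:R :> rat by rewrite ltr0n (leq_trans _ al2).
have th0 : 0 < th by apply: lt_le_trans eth.
rewrite /D' /next_factor; set de := if _ then _ else _.
set de' := Num.max de _.
have lim0 : 0 < 1 / ((par_alpha P)%:R * D) by rewrite divr_gt0 // mulr_gt0.
have de0 : 0 < de' by rewrite lt_max lim0 orbT.
have [j [-> hj]] := scale_factorP de0.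
have viole := violation_le (divr_ge0 (ltW e0) (ltW D0)) acc.
have gape : duality_gap L x y <= g / D ^+ 2 by case: acc.
(* Used with [t = th], where [1 <= D] yields the condition on the gap, and with [t = e] once
   [g <= e * D]. *)
have bound t : e <= t -> (par_gap P -> g <= t * D) -> de' * D <= t.
  move=> et gt; rewrite -ler_pdivlMr // ge_max; apply/andP; split; last first.
    rewrite div1r invfM ler_pM2r ?invr_gt0 //; exact: le_trans et.
  have ve : violation L x y <= t / D.
    by apply: le_trans viole _; rewrite ler_pM2r ?invr_gt0.
  rewrite /de; case: ifP => // gap; rewrite ge_max ve /=.
  apply: le_trans gape _; rewrite ler_pdivrMr ?exprn_gt0 // expr2 mulrA.
  rewrite divfK ?gt_eqF //.
  exact: gt.
have hj1 : de'^-1 <= 2 ^ j by rewrite hj.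
have grow t : 0 < t -> de' * D <= t -> D <= t * 2 ^ j.
  move=> t0 h; apply: le_trans (_ : t * de'^-1 <= _); last by rewrite ler_pM2l.
  by rewrite ler_pdivlMr // mulrC.
have g1 : D <= th * 2 ^ j.
  apply: grow => //; apply: bound => // /gth h; apply: le_trans h _.
  by rewrite ler_peMr // ltW.
(* Minimality of the exponent gives [2 ^ (j - 1) < de'^-1], and [de'] is at least the incremental
   scaling limit. *)
have g3 : 2 ^ j <= 2 * (par_alpha P)%:R * D.
  have : ~~ (de'^-1 <= 2 ^ (j - 1)) by rewrite hj -ltNge ltrBlDr ltrDl.
  rewrite -ltNge expfzDr // exprN1 => h.
  have : de'^-1 <= (par_alpha P)%:R * D.
    rewrite -[X in _ <= X]invrK lef_pV2 ?posrE ?invr_gt0 ?mulr_gt0 //.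
    by rewrite -div1r le_max lexx orbT.
  by rewrite -mulrA; lra.
have Dj : 2 ^ d%:Z <= 2 ^ j :> rat.
  apply: le_trans g1 _; rewrite ler_piMl ?exprz_ge0 // ltW //.
rewrite ler_eXz2l ?ltr1n // in Dj.
case: j => j in hj hj1 g1 g3 Dj grow *; last by move: Dj; clear; lia.
split=> //.
- exists j => //; apply/andP; split; first by move: Dj; clear; lia.
  rewrite -(ler_eXn2l (x := 2 : rat)) ?ltr1n // exprD; apply: le_trans g3 _.
  by rewrite mulrC ler_pM2l // -natrM -natrX ler_nat.
- by move=> h; apply: grow => //; apply: bound.
Qed.

(** * Invariant of the iterates *)

Definition oracle_accurate (p : nat) (e g : rat) (O : oracle) : Prop :=
  forall (m n : nat) (L : lp m n), row_free (lpA L) ->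
  if O m n (round_lp p L) is Some (Answer x y B) then
    [/\ accurate e g L x y B, forall i, limited p (x i 0)
      & forall j, limited p (y j 0)]
  else True.

(** This controls the length of an iterate: the grid bounds the denominator, the number [k] of
    oracle answers added up so far bounds the magnitude. *)
Definition on_grid (p k : nat) (D v : rat) : Prop :=
  v * (2 ^+ p * D) \is a Num.int /\ `|v| <= k%:R * 2 ^+ p.

(** There are two growth rates: [th] is valid from the start, [e] only up to the constant [c], which
    absorbs the steps limited by the gap. The exponent [k.-1] fits the start with [D = 1] at
    [k = 1]. *)
Definition iterate (p w : nat) (e g th c : rat) m n (L : lp m n)
    (k : nat) (D : rat) (x : 'cV[rat]_n) (y : 'cV[rat]_m) : Prop :=
  [/\ exists2 d, D = 2 ^+ d & (d <= w * k)%N,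
      c <= D * e ^+ k, 1 <= D * th ^+ k.-1,
      exists B, accurate (e / D) (g / D ^+ 2) L x y B
    & (forall i, on_grid p k D (x i 0)) /\ (forall j, on_grid p k D (y j 0))].

(** Powers of two with nondecreasing exponents give nested grids, and the correction is at most
    [2 ^+ p] in magnitude. *)
Lemma on_grid_step p k d d' v z : (d <= d')%N -> limited p z ->
  on_grid p k (2 ^+ d) v -> on_grid p k.+1 (2 ^+ d') (v + (2 ^+ d')^-1 * z).
Proof.
move=> dd [u hu ->] [v1 v2].
have D0 : 2 ^+ d' != 0 :> rat by rewrite expf_neq0.
have p0 : 2 ^+ p != 0 :> rat by rewrite expf_neq0.
split.
- have -> : (v + (2 ^+ d')^-1 * (u%:~R / 2 ^+ p)) * (2 ^+ p * 2 ^+ d') =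
      v * (2 ^+ p * 2 ^+ d) * 2 ^+ (d' - d) + u%:~R.
    have -> : 2 ^+ d' = 2 ^+ d * 2 ^+ (d' - d) :> rat by rewrite -exprD subnKC.
    by field; rewrite p0 !expf_neq0.
  by rewrite rpredD ?intr_int // rpredM // rpredX // (intr_nat _ 2).
- apply: le_trans (ler_normD _ _) _.
  rewrite -[k.+1%:R]natr1 mulrDl mul1r lerD //.
  rewrite !normrM !normfV !(ger0_norm (exprn_ge0 _ _)) //.
  have hu' : `|u%:~R| / 2 ^+ p <= 2 ^+ p :> rat.
    rewrite ler_pdivrMr ?exprn_gt0 // -exprD addnn -mul2n.
    by rewrite -intr_norm -[2]/(2%:~R) -rmorphXn ler_int.
  apply: le_trans hu'; rewrite ler_piMl ?divr_ge0 ?exprn_ge0 //.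
  by rewrite invf_le1 ?exprn_gt0 // exprn_ege1.
Qed.

Lemma iterate_step p (P : params) (w k0 : nat) (e g th : rat) (O : oracle) m n
    (L : lp m n) k D x y xh yh B :
  let D' := next_factor P L D x y in
  let c := e ^+ k0.+1 in
  (2 <= par_alpha P)%N -> (par_alpha P)%:R^-1 <= e -> 0 < e ->
  e <= th -> th < 1 -> 0 <= g -> (par_gap P -> g <= th) ->
  (2 * par_alpha P <= 2 ^ w)%N -> g * th ^+ k0 <= e ->
  oracle_accurate p e g O -> row_free (lpA L) -> (0 < k)%N ->
  iterate p w e g th c L k D x y ->
  O m n (round_lp p (scaled_residual D' L x y)) = Some (Answer xh yh B) ->
  iterate p w e g th c L k.+1 D' (x + D'^-1 *: xh) (y + D'^-1 *: yh).
Proof.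
move=> D' c al2 ale e0 eth th1 g0 gth hw hk0 hO rf k_gt0.
move=> [[d DE dwk] cD D1 [Bx acc] [gx gy]] OE; subst D.
have [[d' D'E /andP[dd' d'd]] h1 h2 _] :=
  next_factorP (B := Bx) al2 ale e0 eth g0 gth hw th1 acc.
rewrite -/D' in D'E h1 h2.
have D'0 : 0 < D' by rewrite D'E exprn_gt0.
have D0 : 0 < 2 ^+ d :> rat by rewrite exprn_gt0.
have th0 : 0 < th by apply: lt_le_trans eth.
have := hO _ _ (scaled_residual D' L x y) rf; rewrite OE => -[acc' lx ly].
split.
- exists d' => //; rewrite mulnS addnC; apply: leq_trans d'd _.
  by rewrite leq_add2r.
(* Up to step [k0], the bound is trivial as [c <= e ^+ k.+1] and [D' >= 1]. Afterwards the growth at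
   rate [th] has reached [g <= e * D], which unlocks the rate [e]. *)
- have [kk|kk] := leqP k k0.
    apply: le_trans (_ : e ^+ k.+1 <= _).
      by rewrite /c ler_wiXn2l ?(ltW e0) // (le_trans eth) // ltW.
    by rewrite ler_peMl ?exprn_ge0 ?(ltW e0) // D'E exprn_ege1.
  have gD : g <= e * 2 ^+ d.
    apply: le_trans (_ : g * (2 ^+ d * th ^+ k.-1) <= _).
      by rewrite ler_peMr.
    rewrite mulrCA mulrC ler_pM2r //; apply: le_trans hk0.
    rewrite ler_wpM2l // ler_wiXn2l ?(ltW th0) ?(ltW th1) //.
    by rewrite -ltnS prednK.
  apply: le_trans cD _.
  rewrite (_ : D' * _ = e * D' * e ^+ k); last by rewrite exprS; ring.
  by rewrite ler_wpM2r ?exprn_ge0 ?(ltW e0) // h2.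
- apply: le_trans D1 _; rewrite -[k.+1.-1](prednK k_gt0).
  rewrite (_ : D' * _ = th * D' * th ^+ k.-1); last by rewrite exprS; ring.
  by rewrite ler_wpM2r ?exprn_ge0 ?(ltW th0).
- exists B; exact: accurate_refine.
- split=> i; rewrite mxE [X in _ + X]mxE D'E.
    by apply: on_grid_step (gx i).
  by apply: on_grid_step (gy i).
Qed.

(** With [c <= D * e ^+ k], the condition on [k] yields [4 * alpha * N ^+ 2 * beta ^+ k < D] for
    [N = 2 ^+ (2 * E)]. Then [D <= D'] makes [M2] at least [N], and [D' <= 2 * alpha * D] keeps it
    below [alpha * D], small enough for the error [e / D]. *)
Lemma reconstruct_iterate p s d (P : params) (w E : nat) (e g th c : rat) m n
    (L : lp m n) k D x y :
  E = (s + (s * s + s * (s + s)) + 3 * s + 1)%N ->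
  (2 <= par_alpha P)%N -> (par_alpha P)%:R^-1 <= e -> 0 < e ->
  e <= th -> th < 1 -> 0 <= g -> (par_gap P -> g <= th) ->
  (2 * par_alpha P <= 2 ^ w)%N -> 1 <= par_beta P ->
  (m <= s)%N -> (n <= s)%N -> clears_denominators s d L ->
  4 * (par_alpha P)%:R * 2 ^+ (4 * E) * (e * par_beta P) ^+ k < c ->
  iterate p w e g th c L k D x y ->
  exists xs ys, cval (reconstruct P L k (next_factor P L D x y) x y) =
    Some (xs, ys).
Proof.
move=> EE al2 ale e0 eth th1 g0 gth hw be1 ms ns sL hc.
move=> [[d0 DE _] cD _ [Bx acc] _].
have acc' : accurate (e / 2 ^+ d0) (g / (2 ^+ d0) ^+ 2) L x y Bx by rewrite -DE.
have [[d' D'E /andP[dd' _]] _ _ h3] :=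
  next_factorP al2 ale e0 eth g0 gth hw th1 acc'.
rewrite -DE in D'E h3.
set D' := next_factor _ _ _ _ _ in D'E h3 *.
have D0 : 0 < D by rewrite DE exprn_gt0.
have DD' : D <= D' by rewrite D'E DE ler_eXn2l ?ltr1n.
have a1 : 1 <= (par_alpha P)%:R :> rat by rewrite ler1n (leq_trans _ al2).
have b1 : 1 <= par_beta P ^+ k by rewrite exprn_ege1.
have ek0 : 0 < e ^+ k by rewrite exprn_gt0.
set N : rat := 2 ^+ (2 * E).
have N1 : 1 <= N by rewrite exprn_ege1.
have NN : 2 ^+ (4 * E) = N * N :> rat by rewrite -exprD -mulnDl.
have main : 4 * (par_alpha P)%:R * (N * N) * par_beta P ^+ k < D.
  rewrite -(ltr_pM2r ek0) -NN; apply: lt_le_trans cD; apply: le_lt_trans hc.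
  by rewrite exprMn -!mulrA [_ ^+ k * e ^+ k]mulrC.
apply: (@reconstruct_accurate s d P m n L k D' x y (e / D) (g / D ^+ 2) Bx)
  => //.
- by rewrite divr_ge0 // ltW.
- rewrite -EE -/N ler_pdivlMr; last by rewrite mulr_gt0 //; lra.
  apply: le_trans DD'; apply: le_trans (ltW main).
  rewrite (mulrA N) ler_wpM2r //; first by lra.
  have : N <= N * N by rewrite ler_peMl //; lra.
  have : N * N <= (par_alpha P)%:R * (N * N).
    by rewrite ler_peMl //; apply: mulr_ge0; lra.
  have -> : 4 * (par_alpha P)%:R * (N * N) = 4 * ((par_alpha P)%:R * (N * N)).
    by ring.
  lra.
- rewrite -EE -/N.
  have De : (N * (e / D)) ^+ 2 <= (N * N) / D ^+ 2.
    have -> : (N * (e / D)) ^+ 2 = e ^+ 2 * ((N * N) / D ^+ 2).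
      by field; rewrite gt_eqF.
    rewrite ler_piMl //.
      by rewrite divr_ge0 ?exprn_ge0 ?mulr_ge0 ?(ltW D0) //; lra.
    by rewrite exprn_ile1 ?(ltW e0) // (le_trans eth) // ltW.
  have M2 : D' / (2 * par_beta P ^+ k) <= (par_alpha P)%:R * D.
    rewrite ler_pdivrMr; last by rewrite mulr_gt0 //; lra.
    apply: le_trans h3 _.
    have -> : (par_alpha P)%:R * D * (2 * par_beta P ^+ k) =
       2 * (par_alpha P)%:R * D * par_beta P ^+ k by ring.
    by rewrite ler_peMr //; apply: mulr_ge0; [lra|exact: ltW].
  apply: le_lt_trans (_ : 4 * ((par_alpha P)%:R * D * (N * N / D ^+ 2)) < 1).
    rewrite ler_pM2l // ler_pM ?sqr_ge0 //.
    apply: divr_ge0; first exact: le_trans (ltW D0) DD'.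
    by apply: mulr_ge0 => //; lra.
  have -> : 4 * ((par_alpha P)%:R * D * (N * N / D ^+ 2)) =
      4 * (par_alpha P)%:R * (N * N) / D by field; rewrite gt_eqF.
  rewrite ltr_pdivrMr // mul1r; apply: le_lt_trans main.
  by rewrite ler_peMr //; apply: mulr_ge0; apply: mulr_ge0; lra.
Qed.

(* Attempts of reconstruction fail only before iteration K, and such an     *)
(* attempt postpones the next one to iteration F * K at the latest.         *)
Lemma loop_terminates (O : oracle) (P : params) m n (L : lp m n)
    (Inv : nat -> rat -> 'cV[rat]_n -> 'cV[rat]_m -> Prop) (K F bits : nat) :
  0 <= par_f P <= F%:R -> (0 < F)%N ->
  (forall k D x y xh yh B, let D' := next_factor P L D x y in
    (0 < k)%N -> Inv k D x y ->
    O m n (round_lp (par_p P) (scaled_residual D' L x y)) =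
      Some (Answer xh yh B) ->
    Inv k.+1 D' (x + D'^-1 *: xh) (y + D'^-1 *: yh)) ->
  (forall k D x y, (K <= k)%N -> Inv k D x y -> exists xs ys,
    cval (reconstruct P L k (next_factor P L D x y) x y) = Some (xs, ys)) ->
  (forall (k kstar : nat) D x y, (k <= F * K)%N -> (kstar <= F * K)%N ->
    Inv k D x y ->
    (cbits (step O P L (State k kstar%:R D x y)) <= bits)%N /\
    (ccalls (step O P L (State k kstar%:R D x y)) <= 1)%N) ->
  forall (j k kstar : nat) D x y, (k + j = F * K)%N -> (0 < k)%N ->
  (kstar <= F * K)%N -> Inv k D x y ->
  exists o b c, [/\ loop O P L (State k kstar%:R D x y) o b c,
    o = Aborted \/ exists xs ys, o = Returned xs ys /\ optimal L xs ys,
    (b <= j.+1 * bits)%N & (c <= j.+1)%N].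
Proof.
move=> /andP[f0 fF] F0 hinv hrec hcost.
pose ok o := o = Aborted \/ exists xs ys, o = Returned xs ys /\ optimal L xs ys.
have progress k (kstar : nat) D x y :
    (0 < k <= F * K)%N -> (kstar <= F * K)%N ->
    Inv k D x y ->
    let v := cval (step O P L (State k kstar%:R D x y)) in
    (exists2 o, v = inl o & ok o) \/
    exists (kstar' : nat) D' x' y', [/\ v = inr (State k.+1 kstar'%:R D' x' y'),
      (k < F * K)%N, (kstar' <= F * K)%N & Inv k.+1 D' x' y'].
  move=> /andP[k0 kFK] ks inv; rewrite cval_step.
  case: eqP => [h|_].
    left; exists (Returned x y) => //; right; exists x, y; split=> //.
    have v0 := violation_ge0 L x y.
    have h1 : violation L x y <= 0 by rewrite -h le_max lexx.
    have h2 : duality_gap L x y <= 0 by rewrite -h le_max lexx orbT.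
    have g0 : 0 <= duality_gap L x y by exact: normr_ge0.
    by apply: violation0_optimal; apply: le_anti; rewrite ?h1 ?h2.
  have KFK : (K <= F * K)%N by rewrite leq_pmull.
  set D' := next_factor P L D x y; rewrite ler_nat.
  case Ec: (if _ then _ else _) => [[xs ys]|].
    left; exists (Returned xs ys) => //; right; exists xs, ys; split=> //.
    by move: Ec; case: ifP => // _; exact: reconstruct_optimal.
  case EO: (O m n _) => [[xh yh Bh]|]; last by left; exists Aborted; [|left].
  right; have inv' := hinv _ _ _ _ _ _ _ k0 inv EO.
  case: ifP Ec => hk Ec.
    have kK : (k < K)%N.
      rewrite ltnNge; apply/negP => Kk; have [xs [ys]] := hrec _ _ _ _ Kk inv.
      by rewrite Ec.
    have fk0 : 0 <= par_f P * k%:R by rewrite mulr_ge0.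
    have c0 : 0 <= Num.ceil (par_f P * k%:R).
      by rewrite ceil_ge0; apply: lt_le_trans fk0.
    have cF : Num.ceil (par_f P * k%:R) <= (F * K)%N%:Z.
      rewrite ceil_le_int -pmulrn natrM ler_pM // ler_nat.
      exact: ltnW.
    have cE : `|Num.ceil (par_f P * k%:R)|%N%:R =
        (Num.ceil (par_f P * k%:R))%:~R :> rat.
      by rewrite pmulrn gez0_abs.
    exists `|Num.ceil (par_f P * k%:R)|%N; do 3 eexists.
    split; last exact: inv'.
    - by rewrite cE.
    - exact: leq_trans KFK.
    - by rewrite -lez_nat gez0_abs.
  (* Without an attempt, [k < kstar], and [kstar] is at most [F * K]. *)
  exists kstar; do 3 eexists; split; last exact: inv'; rewrite ?ks //.
  by apply: leq_trans ks; rewrite ltnNge hk.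
(* [j] counts the iterations left until [F * K], where [progress] excludes a further one. *)
elim=> [|j IH] k kstar D x y kj k0 ks inv;
  have kFK : (0 < k <= F * K)%N by rewrite k0 -kj leq_addr.
  have [hb hc] := hcost k kstar D x y (proj2 (andP kFK)) ks inv.
  have [[o vE oko]|[? [? [? [? [_ kF _ _]]]]]] := progress _ _ _ _ _ kFK ks inv.
    by exists o; do 2 eexists; split; [exact: loop_exit vE|..]; rewrite ?mul1n.
  by move: kF; rewrite -kj addn0 ltnn.
have [hb hc] := hcost k kstar D x y (proj2 (andP kFK)) ks inv.
have [[o vE oko]|[ks' [D' [x' [y' [vE kF ks'F inv']]]]]] :=
  progress _ _ _ _ _ kFK ks inv.
  exists o; do 2 eexists; split; [exact: loop_exit vE|exact: oko|..].
    by rewrite mulSn; apply: leq_trans hb (leq_addr _ _).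
  exact: leq_trans hc _.
have [||o [b [c [lo oko lb lc]]]] := IH k.+1 ks' D' x' y' _ _ ks'F inv' => //.
  by rewrite addSnnS.
exists o; do 2 eexists; split; [exact: loop_next vE lo|exact: oko|..].
  by rewrite mulSn leq_add.
by rewrite -[j.+2]add1n leq_add.
Qed.

(** * Polynomial bounds *)

Lemma qsize_le_mxsize m n (A : 'M[rat]_(m, n)) i j :
  (qsize (A i j) <= mxsize A)%N.
Proof.
rewrite /mxsize (bigD1 i) //= (bigD1 j) //=.
by rewrite -addnA leq_addr.
Qed.

Lemma leq_mxsize n (v : 'cV[rat]_n) : (n <= mxsize v)%N.
Proof.
rewrite -{1}[n]card_ord -sum1_card; apply: leq_sum => i _.
by rewrite big_ord1.
Qed.

(** The product of all denominators: sizes add up as denominators multiply. *)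
Lemma common_denominator m n (A : 'M[rat]_(m, n)) :
  exists D, [/\ 1 <= D <= 2 ^+ mxsize A, D \is a Num.int
    & forall i j, D * A i j \is a Num.int].
Proof.
pose f i j : rat := (denq (A i j))%:~R.
have f1 i j : 1 <= f i j <= 2 ^+ qsize (A i j).
  rewrite ler1z -gtz0_ge1 denq_gt0 /=.
  by have /andP[] := bitbound_qsize (A i j).
have fint i j : f i j \is a Num.int by exact: intr_int.
exists (\prod_i \prod_j f i j); split.
- rewrite /mxsize -prodrXr; apply/andP; split.
    have ge1 k (F : 'I_k -> rat) : (forall i, 1 <= F i) -> 1 <= \prod_i F i.
      by move=> h; apply: (big_ind (fun v => 1 <= v)) => // *; exact: mulr_ege1.
    by apply: (ge1 _ _) => i; apply: ge1 => j; case/andP: (f1 i j).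
  apply: ler_prod => i _; rewrite -prodrXr; apply/andP; split.
    apply: prodr_ge0 => j _; case/andP: (f1 i j) => h _; exact: le_trans h.
  apply: ler_prod => j _; case/andP: (f1 i j) => h ->; rewrite andbT.
  exact: le_trans h.
- by apply: rpred_prod => i _; apply: rpred_prod => j _.
move=> i j; rewrite (bigD1 i) //= (bigD1 j) //=.
set X := \prod_(k | _) _; set Y := \prod_(k | _) _.
have -> : f i j * X * Y * A i j = A i j * f i j * (X * Y) by ring.
rewrite mul_denq rpredM ?intr_int // rpredM // rpred_prod // => k _.
by apply: rpred_prod.
Qed.

Lemma lp_scales m n (L : lp m n) : exists d, clears_denominators (lpsize L) d L.
Proof.
have [dA [/andP[A1 A2] Ai AI]] := common_denominator (lpA L).
have [db [/andP[b1 b2] bi bI]] := common_denominator (lpb L).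
have [dc [/andP[c1 c2] ci cI]] := common_denominator (lpc L).
have [dl [/andP[l1 l2] li lI]] := common_denominator (lpl L).
have pos x : 1 <= x -> 0 <= x :> rat by exact: le_trans.
exists (dA * db * dc * dl); split.
- apply/andP; split; first by rewrite !mulr_gt0 //; apply: lt_le_trans ltr01 _.
  by rewrite /lpsize !exprD !ler_pM ?mulr_ge0 ?pos.
- by rewrite !rpredM.
- move=> i j; split.
    have /andP[_ h] := bitbound_qsize (lpA L i j).
    apply: le_trans (le_trans _ h) _; first by rewrite lerDl.
    rewrite ler_eXn2l ?ltr1n // /lpsize -!addnA.
    exact: leq_trans (qsize_le_mxsize _ _ _) (leq_addr _ _).
  have -> : dA * db * dc * dl * lpA L i j = db * dc * dl * (dA * lpA L i j).
    by ring.
  by rewrite rpredM // !rpredM.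
- move=> j; have -> : dA * db * dc * dl * lpb L j 0 =
    dA * dc * dl * (db * lpb L j 0) by ring.
  by rewrite rpredM // !rpredM.
- move=> i; split.
    have -> : dA * db * dc * dl * lpc L i 0 = dA * db * dl * (dc * lpc L i 0).
      by ring.
    by rewrite rpredM // !rpredM.
  have -> : dA * db * dc * dl * lpl L i 0 = dA * db * dc * (dl * lpl L i 0).
    by ring.
  by rewrite rpredM // !rpredM.
Qed.

(** The dimensions are covered as well, since each entry of the cost vector contributes at least 1
    to the size. *)
Lemma lp_bitbound_lpsize m n (L : lp m n) :
  (m <= n)%N -> lp_bitbound (lpsize L) L.
Proof.
move=> mn; have ns : (n <= lpsize L)%N.
  apply: leq_trans (leq_mxsize (lpc L)) _; rewrite /lpsize; clear; lia.
have up a s : (qsize a <= s)%N -> bitbound s a.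
  by move=> h; exact: bitbound_le h (bitbound_qsize a).
split; first by split=> //; exact: leq_trans ns.
all: move=> *; apply: up; apply: leq_trans (qsize_le_mxsize _ _ _) _.
all: by rewrite /lpsize; clear; lia.
Qed.

Lemma expr_unbounded (r M : rat) : 1 < r -> exists N, M < r ^+ N.
Proof.
move=> r1; have r0 : 0 < r - 1 by lra.
have bern N : 1 + N%:R * (r - 1) <= r ^+ N.
  elim: N => [|N IH]; first by rewrite mul0r addr0 expr0.
  have n0 : 0 <= N%:R :> rat by exact: ler0n.
  have : r * (1 + N%:R * (r - 1)) <= r * r ^+ N by rewrite ler_pM2l //; lra.
  rewrite exprS -[N.+1%:R]natr1.
  have : 0 <= N%:R * ((r - 1) * (r - 1)) by rewrite !mulr_ge0 // ltW.
  lra.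
have q0 : 0 <= `|M| / (r - 1) by rewrite divr_ge0 // ltW.
exists (Num.bound (`|M| / (r - 1))); apply: lt_le_trans (bern _).
have := archi_boundP q0; rewrite ltr_pdivrMr //.
by have := ler_norm M; lra.
Qed.

Lemma oracle_accurate_limited (R : realType) p (eta sigma : R) e g O :
  limited_precision_lp_basis_oracle p eta sigma O ->
  eta <= ratr e -> sigma <= ratr g -> oracle_accurate p e g O.
Proof.
move=> hO ee sg m n L rf; have := hO m n L rf.
case: (O _ _ _) => [[x y B]|//] [[lx ly] hB [h1 h2 h3] h4 [h5 h6]].
have le (v c : rat) (b : R) : ratr v <= b -> b <= ratr c -> v <= c.
  by move=> vb bc; rewrite -(ler_rat R); exact: le_trans vb bc.
split=> //; split=> //.
- split=> [j|i|i].
  + exact: le (h1 j) ee.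
  + by rewrite lerBlDr -(ler_rat R) rmorphD /=; have := h2 i; lra.
  + by rewrite lerNl -(ler_rat R) rmorphN /=; have := h3 i; lra.
- exact: le h4 sg.
- by split=> i iB; [exact: le (h5 i iB) ee|exact: le (h6 i iB) ee].
Qed.

Lemma limited_bitbound p (z : rat) : limited p z -> bitbound p.+1 z.
Proof.
move=> [u hu ->]; have p0 : 0 < 2 ^+ p :> rat by rewrite exprn_gt0.
have pE : (2 ^+ p : int)%:~R = 2 ^+ p :> rat by rewrite rmorphXn.
have two k : 1 <= 2 ^+ k :> rat by rewrite exprn_ege1.
apply: (@bitboundP _ _ (2 ^+ p)).
- exact: exprn_gt0.
- by rewrite pE divfK ?gt_eqF // intr_int.
- by rewrite pE ler_eXn2l ?ltr1n.
have : `|u%:~R / 2 ^+ p| <= 2 ^+ p :> rat.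
  rewrite normrM normfV (gtr0_norm p0) ler_pdivrMr // -exprD addnn -mul2n.
  by rewrite -intr_norm -[2]/(2%:~R) -rmorphXn ler_int.
by rewrite exprS; have := two p; lra.
Qed.

Lemma on_grid_bitbound p k d v :
  on_grid p k (2 ^+ d) v -> bitbound (p + d + k) v.
Proof.
move=> [v1 v2]; have E : (2 ^+ (p + d) : int)%:~R = 2 ^+ p * 2 ^+ d :> rat.
  by rewrite rmorphXn exprD.
apply: (@bitboundP _ _ (2 ^+ (p + d))).
- exact: exprn_gt0.
- by rewrite E.
- by rewrite rmorphXn ler_eXn2l ?ltr1n // leq_addr.
apply: le_trans (_ : k.+1%:R * 2 ^+ p <= _).
  by rewrite -[k.+1%:R]natr1 mulrDl mul1r lerD // exprn_ege1.
rewrite addnAC exprD -[X in X <= _]mulr1 ler_pM ?exprn_ege1 //.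
  by rewrite mulr_ge0 // ?ler0n ?exprn_ge0.
rewrite exprD mulrC ler_wpM2l ?exprn_ge0 // -natrX ler_nat.
exact: ltn_expl.
Qed.

(** The constants and [T] are chosen from the parameters alone, before the oracle and the LP; only
    the values of [E], [K] and [S] vary with the size. *)
Lemma polynomial_run (p alpha : nat) (beta f e g : rat) (gap : bool) :
  let P := Params p alpha beta f gap in
  (2 <= alpha)%N -> alpha%:R^-1 <= e -> 0 < e -> 1 <= beta -> e * beta < 1 ->
  0 <= f -> 0 <= g -> (gap -> g < 1) ->
  exists T : {poly nat}, forall O, oracle_accurate p e g O ->
  forall m n (L : lp m n), (m <= n)%N -> row_free (lpA L) ->
  exists o bits calls,
    [/\ run O P L o bits calls,
        o = Aborted \/ exists xs ys, o = Returned xs ys /\ optimal L xs ys,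
        (calls <= T.[lpsize L])%N & (bits <= T.[lpsize L])%N].
Proof.
move=> P al2 ale e0 be1 eb f0 g0 g1.
have eb0 : 0 < e * beta by rewrite mulr_gt0 //; lra.
have e1 : e < 1.
  by apply: le_lt_trans eb; rewrite ler_peMr // ltW.
(* Without the gap in the residual, [g] may exceed 1, but then the factors grow by [1 / e] from the
   start. *)
pose th := if gap then Num.max e g else e.
have [eth th1 gth] : [/\ e <= th, th < 1 & gap -> g <= th].
  rewrite /th; case: (gap) g1 => [/(_ isT) g1|_]; last by [].
  by rewrite le_max lexx gt_max e1 g1 le_max lexx orbT.
have th0 : 0 < th by exact: lt_le_trans eth.
have [k0 hk0] : exists k0, g * th ^+ k0 <= e.
  have [|k0 h] := @expr_unbounded th^-1 (g / e); first by rewrite invf_gt1.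
  exists k0; rewrite exprVn ltr_pdivrMr // in h.
  by rewrite -ler_pdivlMr ?exprn_gt0 // mulrC ltW.
pose w := (2 * alpha)%N; have hw : (2 * alpha <= 2 ^ w)%N.
  by rewrite ltnW // ltn_expl.
pose c := e ^+ k0.+1; have c0 : 0 < c by rewrite exprn_gt0.
(* [N1] steps at least halve [(e * beta) ^+ k]. In [K] below, [4 * E s] halvings compensate
   [2 ^+ (4 * E s)], and [N2] further ones compensate [4 * alpha / c]. *)
have [N1 hN1] : exists N1, (e * beta) ^+ N1 <= 2^-1.
  have [|N1 h] := @expr_unbounded (e * beta)^-1 2; first by rewrite invf_gt1.
  exists N1; rewrite exprVn in h.
  by rewrite -[X in X <= _]invrK lef_pV2 ?posrE ?invr_gt0 ?exprn_gt0 // ltW.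
have [N2 hN2] : exists N2, 4 * alpha%:R < c * 2 ^+ N2.
  have [|N2 h] := @expr_unbounded 2 (4 * alpha%:R / c); first by rewrite ltr1n.
  by exists N2; rewrite [c * _]mulrC -ltr_pdivrMr.
pose F := (Num.bound f).+1.
have fF : f <= F%:R.
  by apply: le_trans (ltW (archi_boundP f0)) _; rewrite ler_nat.
pose E s := (s + (s * s + s * (s + s)) + 3 * s + 1)%N.
pose K s := (N1 * (4 * E s + N2) + 1)%N.
(* One width for all inputs of a pass: the exponent of [D] is at most [w * (F * K s)], and an entry
   on the grid takes [p + k] bits more. *)
pose S s := (s + (p + (alpha + (qsize beta + qsize f))) +
             (w + 3) * (F * K s) + 3)%N.
have [B1 pB1 hB1] := within_sized_oracle_call.
have [B2 pB2 hB2] := within_step.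
have [T1 hT1] : polyb (fun s => (1 + F * K s + B1 (S s + S s + S s + S s) +
    F * K s * B2 (S s))%N).
  have pE : polyb E by rewrite /E; polyb.
  have pK : polyb K by rewrite /K; polyb.
  have pS : polyb S by rewrite /S; polyb.
  polyb.
exists T1 => O hO m n L mn rf.
set s := lpsize L; have [dd hd] := lp_scales L.
have hL := lp_bitbound_lpsize L mn; rewrite -/s in hL.
have [[ms ns] hA hb hc hl] := hL.
have sS : (s <= S s)%N by rewrite /S -addnA -addnA leq_addr.
have [[msS nsS] hAS hbS hcS hlS] := lp_bitbound_le sS hL.
have pS : (p.+1 <= S s)%N.
  by rewrite /S; move: (F * K s)%N => FK; clear; lia.
have [b1 l1 o1] :=
  hB1 _ _ _ _ O p _ _ _ _ _ _ (ltnW pS) msS nsS hAS hbS hcS hlS.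
have callE : cval (call_oracle O p L) = O m n (round_lp p L).
  exact: cval_call_oracle.
set call := call_oracle O p _ in b1 l1 o1.
have {}callE : cval (call_oracle O (par_p P) L) = O m n (round_lp p L) := callE.
have cb : (cbits (call_oracle O (par_p P) L) <= B1 (S s + S s + S s + S s))%N.
  by move: b1; rewrite /call; case: (L) => A b cc l.
have cl : (ccalls (call_oracle O (par_p P) L) <= 1)%N.
  by move: l1; rewrite /call; case: (L) => A b cc l.
have leT (u : nat) : (u <= 1 + F * K s + B1 (S s + S s + S s + S s) +
    F * K s * B2 (S s))%N -> (u <= T1.[s])%N.
  by move=> h; exact: leq_trans h (hT1 s).
case EO : (O m n (round_lp p L)) callE => [[x y B]|] callE; last first.
  exists Aborted; do 2 eexists; split; [exact: run_abort callE|by left|..].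
    by apply: leT; apply: leq_trans cl _; rewrite -addnA -addnA leq_addr.
  by apply: leT; apply: leq_trans cb _; rewrite addnAC leq_addl.
have := hO m n L rf; rewrite EO => -[acc lx ly].
pose Inv := iterate p w e g th c L.
have inv1 : Inv 1%N 1 x y.
  split.
  - by exists 0%N; rewrite ?expr0.
  - by rewrite mul1r expr1 /c exprS ler_piMr ?(ltW e0) // exprn_ile1 // ltW.
  - by rewrite mulr1.
  - by exists B; rewrite expr1n !divr1.
  - have grid z : limited p z -> on_grid p 1 1 z.
      move=> lz; have z0 : on_grid p 0 (2 ^+ 0) 0.
        by rewrite /on_grid mul0r normr0 mul0r rpred0.
      have := on_grid_step (leqnn 0) lz z0.
      by rewrite add0r expr0 invr1 mul1r.
    by split=> i; exact: grid.
have K0 : (0 < K s)%N by rewrite /K addn1.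
have FK0 : (0 < F * K s)%N by rewrite muln_gt0.
(* The loop starts at [k = 1], which leaves [(F * K s).-1] iterations. *)
have [||k D x' y' xh yh Bh D' k_gt0 inv OE|k D x' y' Kk inv
    |k ks D x' y' kF ksF inv|||||o [b [l [lo oko lb ll]]]] :=
  @loop_terminates O P m n L Inv (K s) F (B2 (S s)) _ _ _ _ _
    (F * K s).-1 1 0 1 x y => //.
- by rewrite f0 fF.
- exact: (@iterate_step p P w k0 e g th O m n L k D x' y' xh yh Bh).
- apply: (@reconstruct_iterate p s dd P w (E s) e g th c) inv => //.
  have ek : (e * beta) ^+ k <= 2^-1 ^+ (4 * E s + N2).
    apply: le_trans (_ : (e * beta) ^+ (N1 * (4 * E s + N2)) <= _).
      rewrite ler_wiXn2l ?(ltW eb0) ?(ltW eb) //.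
      by apply: leq_trans Kk; rewrite leq_addr.
    by rewrite exprM lerXn2r // ?nnegrE ?exprn_ge0 // ?(ltW eb0).
  apply: le_lt_trans (_ : 4 * alpha%:R * 2^-1 ^+ N2 < c); last first.
    by rewrite exprVn ltr_pdivrMr // exprn_gt0.
  rewrite -mulrA ler_wpM2l ?mulr_ge0 ?ler0n //.
  apply: le_trans (_ : 2 ^+ (4 * E s) * 2^-1 ^+ (4 * E s + N2) <= _).
    by rewrite ler_wpM2l // exprn_ge0.
  by rewrite exprD mulrA -exprMn divff // expr1n mul1r.
- have [[d DE dk] _ _ _ [gx gy]] := inv; subst D.
  have le q a b : bitbound a q -> (a <= b)%N -> bitbound b q.
    by move=> h ab; exact: bitbound_le h.
  have dF : (d <= w * (F * K s))%N.
    by apply: leq_trans dk _; rewrite leq_mul2l kF orbT.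
  have SE : (S s = s + (p + (alpha + (qsize beta + qsize f))) +
    (w * (F * K s) + 3 * (F * K s)) + 3)%N by rewrite /S mulnDl.
  have [hcost ? _] : within (B2 (S s)) 1 (fun=> True)
      (step O P L (State k ks%:R (2 ^+ d) x' y')); last by split.
  move: (S s) SE lp_bitbound_le sS => S' S'E _ sS'; move: kF ksF dF.
  move: (w * (F * K s))%N (F * K s)%N S'E => wFK FK S'E kF ksF dF.
  apply: hB2.
  - exact: lp_bitbound_le sS' hL.
  - by rewrite S'E; move: kF; clear; lia.
  - by rewrite S'E /=; clear; lia.
  - by apply: le (bitbound_nat alpha) _; rewrite S'E; clear; lia.
  - by apply: le (bitbound_qsize beta) _; rewrite S'E; clear; lia.
  - by apply: le (bitbound_qsize f) _; rewrite S'E; clear; lia.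
  - by apply: le (bitbound_nat ks) _; rewrite S'E; move: ksF; clear; lia.
  - by apply: le (bitbound_exp2 d) _; rewrite S'E; move: dF; clear; lia.
  - move=> i; apply: le (on_grid_bitbound (gx i)) _.
    by rewrite S'E; move: dF kF; clear; lia.
  - move=> j; apply: le (on_grid_bitbound (gy j)) _.
    by rewrite S'E; move: dF kF; clear; lia.
  move=> L' xh yh Bh L'A OE; rewrite -L'A in rf.
  have := hO _ _ L' rf; rewrite OE => -[_ lx' ly'].
  by split=> i; (apply: le; first exact: limited_bitbound);
    rewrite S'E; clear; lia.
- by rewrite add1n prednK.
exists o; do 2 eexists; split.
- exact: run_loop callE lo.
- exact: oko.
- apply: leT; apply: leq_trans (leq_add cl ll) _.
  by rewrite prednK // -addnA leq_addr.
- apply: leT; rewrite prednK // in lb; apply: leq_trans (leq_add cb lb) _.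
  by rewrite leq_add2r leq_addl.
Qed.

Theorem theorem7 (R : realType) (p : nat) (eta sigma : R)
    (heta : 0 < eta < 1) (hsigma : 0 < sigma)
    (alpha : nat) (halpha : (2 <= alpha)%N)
    (beta : rat) (hbeta : 1 < beta)
    (hbeta_eps : ratr beta < (Num.max eta (alpha%:R^-1))^-1)
    (f : rat) (hf : 1 <= f)
    (gap : bool) (hgap : gap -> sigma < 1) :
  exists P : {poly nat},
  forall (O : oracle), limited_precision_lp_basis_oracle p eta sigma O ->
  forall (m n : nat) (L : lp m n),
    (m <= n)%N -> row_free (lpA L) ->
    (exists x, primal_feasible L x) -> (exists y, dual_feasible L y) ->
    (forall bits calls : nat,
       ~ run O (Params p alpha beta f gap) L Aborted bits calls) ->
  exists (x : 'cV[rat]_n) (y : 'cV[rat]_m) (bits calls : nat),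
    [/\ run O (Params p alpha beta f gap) L (Returned x y) bits calls,
        optimal L x y,
        (calls <= P.[lpsize L])%N
      & (bits <= P.[lpsize L])%N].
Proof.
have [/andP[eta0 eta1] sigma0] := (heta, hsigma).
have beta0 : 0 < ratr beta :> R by rewrite ltr0q; apply: lt_trans hbeta.
have max0 : 0 < Num.max eta alpha%:R^-1 by rewrite lt_max eta0.
(* The condition on [beta] makes this interval nonempty, and a rational in it exists by density. *)
have [e] : exists e : rat,
    ratr e \in `]Num.max eta alpha%:R^-1, (ratr beta)^-1[.
  by apply: rat_in_itvoo; rewrite -[X in X < _]invrK ltf_pV2 ?posrE ?invr_gt0.
rewrite in_itv /= gt_max => /andP[/andP[etae alphae] ebeta].
(* If the gap enters the residual, [sigma < 1] leaves room for [g < 1], so that even gap-limited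
   steps enlarge the scaling factor. *)
have [g] : exists g : rat, ratr g \in `]sigma, (if gap then 1 else sigma + 1)[.
  by apply: rat_in_itvoo; case: (gap) hgap => [|_]; [exact|rewrite ltrDl].
rewrite in_itv /= => /andP[sigmag gtop].
have [] := @polynomial_run p alpha beta f e g gap halpha _ _ _ _ _ _ _.
- rewrite -(ler_rat R) fmorphV /= ratr_nat; exact: ltW.
- by rewrite -(ltr0q R); exact: lt_trans etae.
- exact: ltW.
- by rewrite -(ltr_rat R) rmorphM rmorph1 /= -ltr_pdivlMr // div1r.
- exact: le_trans hf.
- by rewrite -(ler0q R) ltW //; exact: lt_trans sigmag.
- by case: (gap) gtop => // gtop _; rewrite -(ltr_rat R) rmorph1.
move=> T hT; exists T => O hO m n L mn rf _ _ noabort.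
have acc := oracle_accurate_limited hO (ltW etae) (ltW sigmag).
have [o [bits [calls [hrun [oE|[x [y [oE opt]]]] hc hb]]]] :=
  hT O acc m n L mn rf.
  by case: (noabort bits calls); rewrite -oE.
by exists x, y, bits, calls; split; rewrite // -oE.
Qed.
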